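(* Let $G$ be a finite edge-labelled directed graph with labels in $\Sigma_\alpha\cup\Sigma_\beta$, let $u,v$ be two nodes of $G$, and let $\mathcal{P}$ be a finite set of regular expressions representing the paths from $u$ to $v$. If every $\mathcal{R}\in\mathcal{P}$ is WellFormed, then $\mathcal{P}$ can be (effectively) encoded as a set of $\mathrm{EUF}^n$ formulas, one encoding for each $\mathcal{R}\in\mathcal{P}$. Consequently, for such instances $(G,u,v,\mathcal{P})$ it is decidable whether $v$ is $D_\alpha\odot D_\beta$-reachable from $u$.
   Context: Dyck languages. The Dyck language over an alphabet $\{o_i, c_i : 1\le i\le k\}$ of opening labels $o_i$ and matching closing labels $c_i$ is generated by $S\to SS\mid o_i\,S\,c_i\mid\epsilon$. Let $D_\alpha$, $D_\beta$ be Dyck languages over disjoint finite alphabets $\Sigma_\alpha$, $\Sigma_\beta$. A word $w$ over $\Sigma_\alpha\cup\Sigma_\beta$ is in the interleaved Dyck language $D_\alpha\odot D_\beta$ iff its projection $w{\downharpoonright}\Sigma_\alpha$ (erase all letters not in $\Sigma_\alpha$) is in $D_\alpha$ and $w{\downharpoonright}\Sigma_\beta$ is in $D_\beta$. Node $v$ is $D_\alpha\odot D_\beta$-reachable from $u$ iff there is a directed path from $u$ to $v$ whose edge labels, concatenated in order, form a word of $D_\alpha\odot D_\beta$. Path expressions. The set $\mathcal{P}$ represents the paths from $u$ to $v$ if the union of the languages of the expressions in $\mathcal{P}$ is exactly the set of label words of directed paths from $u$ to $v$. WellFormed expressions. A regular expression over $\Sigma_\alpha\cup\Sigma_\beta$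 is WellFormed if it is a finite concatenation of Terms, where a Term is either a Factor or $(\text{Factor})^*$, and a Factor is a finite concatenation of Atomics, an Atomic being a letter $a\in\Sigma_\alpha\cup\Sigma_\beta$ or $\epsilon$. (So there are no nested Kleene stars, and no alternation inside a star.) $\mathrm{EUF}^n$. EUF is first-order logic with equality and uninterpreted functions. $\mathrm{EUF}^n$ has a sort $\mathsf{U}$ (uninterpreted) and a sort $\mathsf{N}$ (natural numbers). Terms of sort $\mathsf{U}$ are $term ::= x\mid f^{lin}(term)\mid g(term,\dots,term)$ with $x$ a variable of sort $\mathsf{U}$, $f$ a finite composition of uninterpreted unary function symbols, $g$ a function symbol of arity $\ge2$, and $lin$ a linear expression with integer coefficients in variables of sort $\mathsf{N}$ (values required non-negative); $f^k(t)$ means $f$ applied $k$ times to $t$. Formulas are Boolean combinations of equalities between terms. For an assignment $\sigma$ of natural numbers to the variables of sort $\mathsf{N}$, $\Psi[\sigma]$ denotes the EUF formula obtained by substituting $\sigma$ and unfolding exponents. Encoding. Let $\mathcal{R}$ be WellFormed with starred terms $(F_1)^*,\dots,(F_q)^*$ in order of occurrence, and introduce one loop-count variable $n_j$ of sort $\mathsf{N}$ for each $(F_j)^*$. For an assignment $\sigma$ of natural numbers to $n_1,\dots,n_q$, let $w_\sigma$ be the word obtained from $\mathcal{R}$ by replacing each $(F_j)^*$ by $F_j$ repeated $\sigma(n_j)$ times. An encoding of $\mathcal{R}$ is a pair of $\mathrm{EUF}^n$ formulas $\Psi_\alpha,\Psi_\beta$ in the variables $n_1,\dots,n_q$ of sort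 $\mathsf{N}$, together with designated variables $s,t$ of sort $\mathsf{U}$ in $\Psi_\alpha$ and $s',t'$ of sort $\mathsf{U}$ in $\Psi_\beta$ (standing for source and target), such that for every $\sigma$: $w_\sigma{\downharpoonright}\Sigma_\alpha\in D_\alpha$ iff $\Psi_\alpha[\sigma]$ entails $s=t$ in EUF, and $w_\sigma{\downharpoonright}\Sigma_\beta\in D_\beta$ iff $\Psi_\beta[\sigma]$ entails $s'=t'$ in EUF. *)

(* Defs.v *)
From Stdlib Require List.
From mathcomp Require Import all_boot all_order all_algebra.

Set Implicit Arguments.
Unset Strict Implicit.
Unset Printing Implicit Defensive.

Inductive letter (k : nat) : Type :=
  | Open of 'I_k
  | Close of 'I_k.

Inductive dyck (k : nat) : seq (letter k) -> Prop :=
  | dyck_eps : dyck [::]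
  | dyck_cat w1 w2 : dyck w1 -> dyck w2 -> dyck (w1 ++ w2)
  | dyck_wrap i w : dyck w -> dyck (Open i :: rcons w (Close i)).

(* The union of the two disjoint alphabets is the sum type. *)
Definition label (ka kb : nat) : Type := (letter ka + letter kb)%type.

Definition proj_alpha ka kb (w : seq (label ka kb)) : seq (letter ka) :=
  pmap (fun l => if l is inl a then Some a else None) w.

Definition proj_beta ka kb (w : seq (label ka kb)) : seq (letter kb) :=
  pmap (fun l => if l is inr b then Some b else None) w.

Definition interleaved_dyck ka kb (w : seq (label ka kb)) : Prop :=
  dyck (proj_alpha w) /\ dyck (proj_beta w).

Record graph (ka kb : nat) := Graph {
  nodes : nat;
  edges : seq ('I_nodes * label ka kb * 'I_nodes)
}.

(* [path_word G u w v]: some directed path (not necessarily simple, possibly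
   empty) from [u] to [v] has label word [w]. *)
Inductive path_word ka kb (G : graph ka kb) :
    'I_(nodes G) -> seq (label ka kb) -> 'I_(nodes G) -> Prop :=
  | path_nil u : path_word u [::] u
  | path_cons u x a w v :
      List.In (u, a, x) (edges G) -> path_word x w v -> path_word u (a :: w) v.

Definition reachable ka kb (G : graph ka kb) (u v : 'I_(nodes G)) : Prop :=
  exists w, path_word u w v /\ interleaved_dyck w.

Inductive regexp (A : Type) : Type :=
  | Void
  | Eps
  | Char of A
  | Plus of regexp A & regexp A
  | Cat of regexp A & regexp A
  | Star of regexp A.

Arguments Void {A}.
Arguments Eps {A}.

Inductive lang (A : Type) : regexp A -> seq A -> Prop :=
  | lang_eps : lang Eps [::]
  | lang_char a : lang (Char a) [:: a]
  | lang_plusl r1 r2 w : lang r1 w -> lang (Plus r1 r2) w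
  | lang_plusr r1 r2 w : lang r2 w -> lang (Plus r1 r2) w
  | lang_cat r1 r2 w1 w2 :
      lang r1 w1 -> lang r2 w2 -> lang (Cat r1 r2) (w1 ++ w2)
  | lang_star0 r : lang (Star r) [::]
  | lang_starS r w1 w2 :
      lang r w1 -> lang (Star r) w2 -> lang (Star r) (w1 ++ w2).

(* [Cat] is binary, so a finite concatenation is any bracketing of its items;
   the empty concatenation is [Eps], itself an atomic expression. *)
Inductive atomic (A : Type) : regexp A -> Prop :=
  | atomic_eps : atomic Eps
  | atomic_char a : atomic (Char a).

Inductive factor (A : Type) : regexp A -> Prop :=
  | factor_atomic r : atomic r -> factor r
  | factor_cat r1 r2 : factor r1 -> factor r2 -> factor (Cat r1 r2).

Inductive wf_term (A : Type) : regexp A -> Prop :=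
  | term_factor r : factor r -> wf_term r
  | term_star r : factor r -> wf_term (Star r).

Inductive well_formed (A : Type) : regexp A -> Prop :=
  | wf_one r : wf_term r -> well_formed r
  | wf_cat r1 r2 : well_formed r1 -> well_formed r2 -> well_formed (Cat r1 r2).

Definition represents_paths ka kb (G : graph ka kb) (u v : 'I_(nodes G))
    (P : seq (regexp (label ka kb))) : Prop :=
  forall w, (exists2 r, List.In r P & lang r w) <-> path_word u w v.

(* Number of starred terms; meaningful for well-formed expressions. *)
Fixpoint nstars (A : Type) (r : regexp A) : nat :=
  match r with
  | Cat r1 r2 => nstars r1 + nstars r2
  | Star _ => 1
  | _ => 0
  end.

(* The word obtained by unrolling the starred terms of [r], which are numbered
   [j], [j + 1], ... from left to right, according to the loop counts [sigma].
   The values on [Void] and [Plus], absent from well-formed expressions, are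
   irrelevant. *)
Fixpoint unroll_from (A : Type) (sigma : nat -> nat) (j : nat) (r : regexp A)
    : seq A :=
  match r with
  | Char a => [:: a]
  | Cat r1 r2 => unroll_from sigma j r1 ++ unroll_from sigma (j + nstars r1) r2
  | Star f => flatten (nseq (sigma j) (unroll_from sigma j f))
  | _ => [::]
  end.

Definition unroll (A : Type) (sigma : nat -> nat) (r : regexp A) : seq A :=
  unroll_from sigma 0 r.

(* Variables and function symbols are named by natural numbers; a symbol is
   identified by its name together with its arity. *)
Inductive euf_term : Type :=
  | EVar of nat
  | EUn of nat & euf_term
  | EApp of nat & euf_term & euf_term & seq euf_term.  (* arity 2 + size *)

Inductive formula (T : Type) : Type :=
  | FEq of T & T
  | FNot of formula T
  | FAnd of formula T & formula T
  | FOr of formula T & formula T.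

(* [app g] restricted to sequences of length [m] interprets the symbol of
   name [g] and arity [m]. *)
Record euf_model := EufModel {
  dom : Type;
  un : nat -> dom -> dom;
  app : nat -> seq dom -> dom
}.

Fixpoint eval_euf (M : euf_model) (rho : nat -> dom M) (t : euf_term) : dom M :=
  match t with
  | EVar x => rho x
  | EUn f t1 => un f (eval_euf rho t1)
  | EApp g t1 t2 ts =>
      app g (eval_euf rho t1 :: eval_euf rho t2 :: map (eval_euf rho) ts)
  end.

Fixpoint sat (M : euf_model) (rho : nat -> dom M) (phi : formula euf_term)
    : Prop :=
  match phi with
  | FEq t1 t2 => eval_euf rho t1 = eval_euf rho t2
  | FNot p => ~ sat rho p
  | FAnd p q => sat rho p /\ sat rho q
  | FOr p q => sat rho p \/ sat rho q
  end.

Definition entails_eq (phi : formula euf_term) (s t : nat) : Prop :=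
  forall (M : euf_model) (rho : nat -> dom M), sat rho phi -> rho s = rho t.

(* [Lin c [:: (a1, j1); ...]] is c + a1 * n_j1 + ... *)
Record lin := Lin { lin_const : int; lin_coefs : seq (int * nat) }.

Definition lin_val (sigma : nat -> nat) (l : lin) : int :=
  (lin_const l + \sum_(m <- lin_coefs l) m.1 * (sigma m.2)%:Z)%R.

(* [NPow [:: f1; ...; fm] l t] is (f1 o ... o fm)^l (t). *)
Inductive eufn_term : Type :=
  | NVar of nat
  | NPow of seq nat & lin & eufn_term
  | NApp of nat & eufn_term & eufn_term & seq eufn_term.

Fixpoint term_lins (t : eufn_term) : seq lin :=
  match t with
  | NVar _ => [::]
  | NPow _ l t1 => l :: term_lins t1
  | NApp _ t1 t2 ts =>
      term_lins t1 ++ term_lins t2 ++ flatten (map term_lins ts)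
  end.

Fixpoint term_vars (t : eufn_term) : seq nat :=
  match t with
  | NVar x => [:: x]
  | NPow _ _ t1 => term_vars t1
  | NApp _ t1 t2 ts =>
      term_vars t1 ++ term_vars t2 ++ flatten (map term_vars ts)
  end.

Fixpoint sides (T : Type) (phi : formula T) : seq T :=
  match phi with
  | FEq t1 t2 => [:: t1; t2]
  | FNot p => sides p
  | FAnd p q | FOr p q => sides p ++ sides q
  end.

Definition exponents (phi : formula eufn_term) : seq lin :=
  flatten (map term_lins (sides phi)).

Definition u_vars (phi : formula eufn_term) : seq nat :=
  flatten (map term_vars (sides phi)).

Definition n_vars (phi : formula eufn_term) : seq nat :=
  flatten [seq map snd (lin_coefs l) | l <- exponents phi].

(* The instance [Psi[sigma]] makes sense only under this condition. *)
Definition exponents_ge0 (sigma : nat -> nat) (phi : formula eufn_term) : bool :=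
  all (fun l => 0 <= lin_val sigma l)%R (exponents phi).

Definition apply_comp (fs : seq nat) (t : euf_term) : euf_term :=
  foldr EUn t fs.

(* The absolute value only serves to view a nonnegative integer as a natural
   number, cf. [exponents_ge0]. *)
Fixpoint subst_term (sigma : nat -> nat) (t : eufn_term) : euf_term :=
  match t with
  | NVar x => EVar x
  | NPow fs l t1 =>
      iter (absz (lin_val sigma l)) (apply_comp fs) (subst_term sigma t1)
  | NApp g t1 t2 ts =>
      EApp g (subst_term sigma t1) (subst_term sigma t2)
        (map (subst_term sigma) ts)
  end.

Fixpoint subst (sigma : nat -> nat) (phi : formula eufn_term)
    : formula euf_term :=
  match phi with
  | FEq t1 t2 => FEq (subst_term sigma t1) (subst_term sigma t2)
  | FNot p => FNot (subst sigma p)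
  | FAnd p q => FAnd (subst sigma p) (subst sigma q)
  | FOr p q => FOr (subst sigma p) (subst sigma q)
  end.

Record st_formula := StFormula {
  psi : formula eufn_term;
  source : nat;
  target : nat
}.

(* [Psi] is over the sort-N variables n_0, ..., n_(q-1), its source and target
   occur in it, and for all loop counts [sigma] it has well-defined instances
   and entails source = target exactly when [Q sigma] holds. *)
Definition expresses (q : nat) (Psi : st_formula) (Q : (nat -> nat) -> Prop)
    : Prop :=
  [/\ all (fun j => j < q) (n_vars (psi Psi)),
      source Psi \in u_vars (psi Psi),
      target Psi \in u_vars (psi Psi)
    & forall sigma : nat -> nat,
        exponents_ge0 sigma (psi Psi) /\
        (Q sigma <->
         entails_eq (subst sigma (psi Psi)) (source Psi) (target Psi))].

Definition is_encoding ka kb (r : regexp (label ka kb))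
    (e : st_formula * st_formula) : Prop :=
  expresses (nstars r) e.1 (fun sigma => dyck (proj_alpha (unroll sigma r))) /\
  expresses (nstars r) e.2 (fun sigma => dyck (proj_beta (unroll sigma r))).

Record problem := Problem {
  ka : nat;
  kb : nat;
  gr : graph ka kb;
  src : 'I_(nodes gr);
  tgt : 'I_(nodes gr);
  exprs : seq (regexp (label ka kb))
}.

Definition valid_problem (I : problem) : Prop :=
  represents_paths (src I) (tgt I) (exprs I) /\
  forall r, List.In r (exprs I) -> well_formed r.

(* The model of computation is N. D. Jones's Turing-complete language I: WHILE
   programs over binary trees with a single variable, which holds the input at
   the start and the output at the end. *)
Inductive tree : Type := Nil | Cons of tree & tree.

Definition hd (d : tree) : tree := if d is Cons a _ then a else Nil.
Definition tl (d : tree) : tree := if d is Cons _ b then b else Nil.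

Inductive expr : Type :=
  | EX
  | ENil
  | ECons of expr & expr
  | EHd of expr
  | ETl of expr.

Inductive cmd : Type :=
  | Assign of expr
  | Seq of cmd & cmd
  | While of expr & cmd.

Fixpoint eval_expr (e : expr) (x : tree) : tree :=
  match e with
  | EX => x
  | ENil => Nil
  | ECons e1 e2 => Cons (eval_expr e1 x) (eval_expr e2 x)
  | EHd e1 => hd (eval_expr e1 x)
  | ETl e1 => tl (eval_expr e1 x)
  end.

(* [exec c x y]: started on [x], the program [c] halts with output [y]. *)
Inductive exec : cmd -> tree -> tree -> Prop :=
  | exec_assign e x : exec (Assign e) x (eval_expr e x)
  | exec_seq c1 c2 x y z : exec c1 x y -> exec c2 y z -> exec (Seq c1 c2) x z
  | exec_while_end e c x : eval_expr e x = Nil -> exec (While e c) x x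
  | exec_while_step e c x y z :
      eval_expr e x <> Nil -> exec c x y -> exec (While e c) y z ->
      exec (While e c) x z.

Definition code_nat (n : nat) : tree := iter n (Cons Nil) Nil.

Definition code_bool (b : bool) : tree := code_nat b.

Definition code_seq (A : Type) (code : A -> tree) (s : seq A) : tree :=
  foldr (fun a d => Cons (code a) d) Nil s.

Definition code_ctor (n : nat) (args : seq tree) : tree :=
  Cons (code_nat n) (code_seq id args).

Definition code_int (z : int) : tree :=
  match z with
  | Posz n => code_ctor 0 [:: code_nat n]
  | Negz n => code_ctor 1 [:: code_nat n]
  end.

Definition code_letter k (a : letter k) : tree :=
  match a with
  | Open i => code_ctor 0 [:: code_nat i]
  | Close i => code_ctor 1 [:: code_nat i]
  end.

Definition code_label ka kb (l : label ka kb) : tree :=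
  match l with
  | inl a => code_ctor 0 [:: code_letter a]
  | inr b => code_ctor 1 [:: code_letter b]
  end.

Fixpoint code_regexp ka kb (r : regexp (label ka kb)) : tree :=
  match r with
  | Void => code_ctor 0 [::]
  | Eps => code_ctor 1 [::]
  | Char a => code_ctor 2 [:: code_label a]
  | Plus r1 r2 => code_ctor 3 [:: code_regexp r1; code_regexp r2]
  | Cat r1 r2 => code_ctor 4 [:: code_regexp r1; code_regexp r2]
  | Star r1 => code_ctor 5 [:: code_regexp r1]
  end.

Definition code_exprs ka kb (P : seq (regexp (label ka kb))) : tree :=
  code_seq (@code_regexp ka kb) P.

Definition code_edge n ka kb (e : 'I_n * label ka kb * 'I_n) : tree :=
  code_seq id [:: code_nat e.1.1; code_label e.1.2; code_nat e.2].

Definition code_problem (I : problem) : tree :=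
  code_seq id
    [:: code_nat (ka I); code_nat (kb I); code_nat (nodes (gr I));
        code_seq (@code_edge _ _ _) (edges (gr I));
        code_nat (src I); code_nat (tgt I); code_exprs (exprs I)].

Definition code_lin (l : lin) : tree :=
  Cons (code_int (lin_const l))
    (code_seq (fun m => Cons (code_int m.1) (code_nat m.2)) (lin_coefs l)).

Fixpoint code_term (t : eufn_term) : tree :=
  match t with
  | NVar x => code_ctor 0 [:: code_nat x]
  | NPow fs l t1 =>
      code_ctor 1 [:: code_seq code_nat fs; code_lin l; code_term t1]
  | NApp g t1 t2 ts =>
      code_ctor 2 [:: code_nat g; code_term t1; code_term t2;
                      code_seq id (map code_term ts)]
  end.

Fixpoint code_formula (phi : formula eufn_term) : tree :=
  match phi with
  | FEq t1 t2 => code_ctor 0 [:: code_term t1; code_term t2]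
  | FNot p => code_ctor 1 [:: code_formula p]
  | FAnd p q => code_ctor 2 [:: code_formula p; code_formula q]
  | FOr p q => code_ctor 3 [:: code_formula p; code_formula q]
  end.

Definition code_st_formula (Psi : st_formula) : tree :=
  code_seq id
    [:: code_formula (psi Psi); code_nat (source Psi); code_nat (target Psi)].

Definition code_encoding (e : st_formula * st_formula) : tree :=
  Cons (code_st_formula e.1) (code_st_formula e.2).

(* Main.v *)
(* Encoding.  A word is a Dyck word iff, read from right to left with closing
   letters pushing and opening letters popping, it takes the empty stack to the
   empty stack.  An opening letter between two positions x and y of the word is
   encoded by x = f(y) and a closing letter by f(x) = y.  Chaining these equations
   along a Dyck word gives source = target; conversely the stacks themselves form
   a model, in which f pops, of the equations of any word.  In the polycyclic
   monoid a word v either vanishes or reduces to closing letters C followed by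
   opening letters B, and v^n with n >= 2 either vanishes or is conjugate to z^n
   with z consisting of letters of one kind only, so that v^n is encoded by one
   equation between powers.  The loop counts 0, 1 and >= 2 are told apart by a
   symbol h with h(a) = b, h(b) = c and h(c) = c.

   Decision.  A well-formed expression is a chain of loops, hence an automaton
   whose accepted words are determined by the numbers of times their edges occur.
   The edge counts of Dyck paths are the solutions of flow equations for a
   context-free grammar whose support is connected (in a balanced and connected
   multiset of rules the leftmost nonterminal can always be expanded so as to stay
   connected).  So some word of the automaton lies in both Dyck languages iff a
   linear system over the naturals has a solution with admissible support.
   Eliminating one equation at a time gives a computable bound on some solution
   with the same support, hence on the length of some path, and a bounded backward
   search decides reachability. *)

From Stdlib Require List.
From Stdlib Require Import Classical_Prop.
From HB Require Import structures.
From mathcomp Require Import all_boot all_order all_algebra zify.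
Require Import Defs.

Set Implicit Arguments.
Unset Strict Implicit.
Unset Printing Implicit Defensive.
Import Order.TTheory GRing.Theory Num.Theory.

(** * Dyck words as stack runs, and well-formed expressions as item sequences *)

(** Entailment quantifies over all models, so for given loop counts the formula has to force source
    = target along a Dyck word and yet leave room for a separating model otherwise. A loop power
    that contains a mismatch is therefore given a trivial equation. A loop count occurs only in
    exponents and cannot select a formula by itself; this is what the symbol h is for. The threshold
    is 2 because [v^0] is empty even if [v] contains a mismatch, and because a clash between the end
    of [v] and its beginning shows only from [v^2] on.

    The decision does not go through the formulas. The linear system treats the two Dyck conditions
    separately and yields two paths with equal edge counts; the chain shape then makes these paths
    equal. The flow argument is classical, whereas the programs are explicit: they work on untyped
    codes and are assembled from closure properties of the computable functions. *)

(* [(true, i)] stands for the opening and [(false, i)] for the closing letter. *)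
Definition nlet : Type := (bool * nat)%type.

Definition nlet_of k (a : letter k) : nlet :=
  match a with Open i => (true, i : nat) | Close i => (false, i : nat) end.

Definition push (i : nat) (o : option (seq nat)) : option (seq nat) :=
  if o is Some s then Some (i :: s) else None.

Definition pop (i : nat) (o : option (seq nat)) : option (seq nat) :=
  if o is Some (j :: s) then if j == i then Some s else None else None.

(* Words are read from right to left, so that closing letters push. *)
Definition bstep (a : nlet) : option (seq nat) -> option (seq nat) :=
  if a.1 then pop a.2 else push a.2.

Definition brun (w : seq nlet) (o : option (seq nat)) : option (seq nat) :=
  foldr bstep o w.

Lemma brun_cat u v o : brun (u ++ v) o = brun u (brun v o).
Proof. exact: foldr_cat. Qed.

Lemma bstep_None a : bstep a None = None.
Proof. by case: a => [[]]. Qed.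

Lemma brun_None w : brun w None = None.
Proof. by elim: w => //= a w ->; rewrite bstep_None. Qed.

Lemma push_popK i o s : pop i o = Some s -> o = Some (i :: s).
Proof. by case: o => //= -[|j t] //; case: eqP => // -> [->]. Qed.

Lemma pop_pushK i : cancel (push i) (pop i).
Proof. by case=> //= s; rewrite eqxx. Qed.

Lemma brun_dyck k (w : seq (letter k)) o : dyck w -> brun (map (@nlet_of k) w) o = o.
Proof.
move=> D; elim: D o => //= [w1 w2 _ IH1 _ IH2|i v _ IH] o.
  by rewrite map_cat brun_cat IH2 IH1.
by rewrite map_rcons -cats1 brun_cat IH /bstep /= pop_pushK.
Qed.

(** Induction on the derivation with the cut left free: a cut of a concatenation falls into one of
    its factors; a pair put at either end of a bracketed word is concatenated to it, and otherwise
    goes inside. *)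
Lemma dyck_insert k (u v : seq (letter k)) i :
  dyck (u ++ v) -> dyck (u ++ Open i :: Close i :: v).
Proof.
have Doc : dyck [:: Open i; Close i] by apply: (@dyck_wrap _ i [::]); exact: dyck_eps.
move Ew: (u ++ v) => w D; elim: D u v Ew => {w}
  [|w1 w2 D1 IH1 D2 IH2|j w D IH] u v Ew.
- by case: u Ew => //; case: v.
- have Eu : u = take (size u) (w1 ++ w2) by rewrite -Ew take_size_cat.
  have Ev : v = drop (size u) (w1 ++ w2) by rewrite -Ew drop_size_cat.
  rewrite {1}Eu Ev take_cat drop_cat; case: ltnP => _.
    rewrite -!cat_cons catA; apply: dyck_cat => //.
    by apply: IH1; rewrite cat_take_drop.
  rewrite -catA; apply: dyck_cat => //.
  by apply: IH2; rewrite cat_take_drop.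
- case: u Ew => [|a u] /=.
    move=> ->; apply: (dyck_cat Doc); exact: dyck_wrap.
  case=> -> {a}; case/lastP: v => [|v a].
    rewrite cats0 => ->; rewrite -[_ :: _]/((Open j :: rcons w (Close j)) ++ _).
    by apply: dyck_cat Doc; apply: dyck_wrap.
  rewrite -rcons_cat => /rcons_inj[Ew ->]; rewrite -!rcons_cons -rcons_cat.
  by apply: dyck_wrap; apply: IH.
Qed.

(** The stack holds the openings still missing on the left, its top being the one nearest to [w],
    hence the reversal. A further closing letter with its missing opening amounts to inserting a
    matching pair. *)
Lemma brun_pending k (w : seq (letter k)) s :
  brun (map (@nlet_of k) w) (Some [::]) = Some s ->
  exists2 t : seq 'I_k, s = map val t & dyck (rev (map (@Open k) t) ++ w).
Proof.
elim: w s => [|[] i w IH] s /=.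
- by case=> <-; exists [::] => //; apply: dyck_eps.
- rewrite /bstep /= => /push_popK/IH[[//|j t]] [Ej ->].
  move/val_inj: Ej => <-; rewrite map_cons rev_cons cat_rcons => D.
  by exists t.
- rewrite /bstep /=; case: (brun _ _) IH => //= s' IH [<-].
  have [t -> D] := IH _ erefl; exists (i :: t) => //.
  by rewrite map_cons rev_cons cat_rcons; apply: dyck_insert.
Qed.

Lemma dyckP k (w : seq (letter k)) :
  dyck w <-> brun (map (@nlet_of k) w) (Some [::]) = Some [::].
Proof.
split=> [/brun_dyck -> //|/brun_pending[[|//] _]].
by [].
Qed.

(* A sequence of items represents a well-formed expression: [inl a] is the
   letter [a] and [inr v] is the starred word [v]. *)
Definition item (A : Type) : Type := (A + seq A)%type.

Definition plain_letters A (l : seq (item A)) : seq A :=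
  pmap (fun it => if it is inl a then Some a else None) l.

Fixpoint items A (r : regexp A) : seq (item A) :=
  match r with
  | Char a => [:: inl a]
  | Cat r1 r2 => items r1 ++ items r2
  | Star f => [:: inr (plain_letters (items f))]
  | _ => [::]
  end.

Fixpoint nloops A (l : seq (item A)) : nat :=
  match l with
  | [::] => 0
  | inl _ :: l' => nloops l'
  | inr _ :: l' => (nloops l').+1
  end.

Fixpoint words A (sigma : nat -> nat) (j : nat) (l : seq (item A)) : seq A :=
  match l with
  | [::] => [::]
  | inl a :: l' => a :: words sigma j l'
  | inr v :: l' => flatten (nseq (sigma j) v) ++ words sigma j.+1 l'
  end.

Section Items.
Variable A : Type.
Implicit Types (l : seq (item A)) (r : regexp A) (sigma : nat -> nat).

Lemma nloops_cat l1 l2 : nloops (l1 ++ l2) = nloops l1 + nloops l2.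
Proof. by elim: l1 => //= -[a|v] l IH //=; rewrite IH. Qed.

Lemma words_cat sigma j l1 l2 :
  words sigma j (l1 ++ l2) = words sigma j l1 ++ words sigma (j + nloops l1) l2.
Proof.
elim: l1 j => [|[a|v] l IH] j /=; rewrite ?addn0 ?IH //.
by rewrite addnS addSn catA.
Qed.

(** A factor contains no star and has exactly one word, so [sigma] and [j] are arbitrary. *)
Lemma factor_words sigma j r : factor r ->
  [/\ nstars r = 0, nloops (items r) = 0, unroll_from sigma j r = words sigma j (items r),
      plain_letters (items r) = words sigma j (items r)
    & forall w, lang r w -> w = words sigma j (items r)].
Proof.
move=> F; elim: F j => {r} [r [|a]|r1 r2 _ IH1 _ IH2] j.
- by split=> // w; move Er: Eps => r' L; case: L Er.
- by split=> // w; move Er: (Char a) => r' L; case: L Er => // b [->].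
- have [s1 n1 u1 p1 L1] := IH1 j; have [s2 n2 u2 p2 L2] := IH2 j.
  split=> /=; rewrite ?nloops_cat ?words_cat ?n1 ?s1 ?n2 ?addn0 //.
  + by rewrite u1 u2.
  + by rewrite /plain_letters pmap_cat -/(plain_letters _) p1 -/(plain_letters _) p2.
  + move=> w; move Er: (Cat r1 r2) => r L.
    by case: L Er => // r1' r2' w1 w2 H1 H2 [E1 E2]; subst; rewrite (L1 _ H1) (L2 _ H2).
Qed.

Lemma factor_lang r : factor r -> lang r (plain_letters (items r)).
Proof.
elim=> {r} [r [|a]|r1 r2 _ IH1 _ IH2] /=.
- exact: lang_eps.
- exact: lang_char.
- by rewrite /plain_letters pmap_cat; apply: lang_cat.
Qed.

Lemma well_formed_unroll r sigma j : well_formed r ->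
  nstars r = nloops (items r) /\ unroll_from sigma j r = words sigma j (items r).
Proof.
move=> W; elim: W j => {r} [r [{}r F|{}r F]|r1 r2 _ IH1 _ IH2] j /=.
- by have [s n u _ _] := factor_words sigma j F; rewrite s n.
- have [_ _ u p _] := factor_words sigma j F.
  by rewrite cats0 u p.
- have [s1 u1] := IH1 j; have [s2 u2] := IH2 (j + nstars r1).
  by rewrite nloops_cat words_cat s2 u1 u2 s1.
Qed.

Lemma lang_star_word r w : factor r -> lang (Star r) w ->
  exists n, w = flatten (nseq n (plain_letters (items r))).
Proof.
move=> F; move Er: (Star r) => r' L; elim: L Er => // [r1 _|r1 w1 w2 L1 _ _ IH [E]].
  by exists 0.
subst r1; have [n ->] := IH erefl; exists n.+1 => /=.
by have [_ _ _ -> L] := factor_words (fun=> 0) 0 F; rewrite (L _ L1).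
Qed.

Lemma eq_words s1 s2 j l :
  (forall i, j <= i < j + nloops l -> s1 i = s2 i) -> words s1 j l = words s2 j l.
Proof.
elim: l j => [|[a|v] l IH] j E //=; first by rewrite IH.
rewrite IH; first by rewrite E // leqnn addnS ltnS leq_addr.
by move=> i Hi; apply: E; rewrite /= addnS -addSn; case/andP: Hi => /ltnW -> ->.
Qed.

(** The two halves of a concatenation use disjoint ranges of loop indices, so their assignments can
    be glued. *)
Lemma well_formed_word r w j : well_formed r -> lang r w ->
  exists sigma, w = words sigma j (items r).
Proof.
move=> W; elim: W w j => {r} [r [{}r F|{}r F]|r1 r2 W1 IH1 W2 IH2] w j L /=.
- exists (fun=> 0); by have [_ _ _ _ E] := factor_words (fun=> 0) j F; apply: E.
- by have [n ->] := lang_star_word F L; exists (fun=> n); rewrite cats0.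
- move Er: (Cat r1 r2) L => r L; case: L Er => // r1' r2' w1 w2 H1 H2 [E1 E2].
  subst r1' r2'; have [s1 E1] := IH1 _ j H1.
  have [s2 E2] := IH2 _ (j + nloops (items r1)) H2.
  exists (fun i => if i < j + nloops (items r1) then s1 i else s2 i).
  rewrite words_cat E1 E2; congr (_ ++ _); apply: eq_words => i /andP[H H'].
    by rewrite H'.
  by rewrite ltnNge H.
Qed.

Lemma words_lang sigma r j : well_formed r -> lang r (words sigma j (items r)).
Proof.
move=> W; elim: W j => {r} [r [{}r F|{}r F]|r1 r2 W1 IH1 W2 IH2] j /=.
- by have [_ _ _ <- _] := factor_words sigma j F; apply: factor_lang.
- rewrite cats0; elim: (sigma j) => [|n IH] /=; first exact: lang_star0.
  by apply: lang_starS IH; apply: factor_lang.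
- by rewrite words_cat; apply: lang_cat.
Qed.

Variables (B : Type) (f : A -> option B).

(** A star is kept even if its word is erased completely, so that both projections number the loops
    alike. *)
Definition item_pmap (it : item A) : option (item B) :=
  match it with
  | inl a => omap inl (f a)
  | inr v => Some (inr (pmap f v))
  end.

Lemma pmap_words sigma j l :
  pmap f (words sigma j l) = words sigma j (pmap item_pmap l).
Proof.
elim: l j => [|[a|v] l IH] j //=; first by case: (f a) => /= [b|]; rewrite IH.
rewrite pmap_cat IH; congr (_ ++ _).
by elim: (sigma j) => //= n IHn; rewrite pmap_cat IHn.
Qed.

Lemma nloops_pmap l : nloops (pmap item_pmap l) = nloops l.
Proof. by elim: l => [|[a|v] l IH] //=; [case: (f a) | rewrite IH]. Qed.

End Items.

(** * Encoding by equations *)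

Lemma brun_flatten v n w o :
  (forall o', brun v o' = brun w o') ->
  brun (flatten (nseq n v)) o = brun (flatten (nseq n w)) o.
Proof. by move=> E; elim: n => //= n IH; rewrite !brun_cat IH E. Qed.

Definition closes (s : seq nat) : seq nlet := [seq (false, i) | i <- s].
Definition opens (s : seq nat) : seq nlet := [seq (true, i) | i <- s].

(* [Some (C, B)] stands for the word [closes C ++ opens B], to which a word
   without mismatch reduces; a word with a mismatch has no normal form. *)
Definition nf_step (a : nlet) (o : option (seq nat * seq nat)) :
    option (seq nat * seq nat) :=
  if o is Some (C, B) then
    if a.1 then
      if C is j :: C' then if j == a.2 then Some (C', B) else None
      else Some ([::], a.2 :: B)
    else Some (a.2 :: C, B)
  else None.

Definition nf (v : seq nlet) : option (seq nat * seq nat) :=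
  foldr nf_step (Some ([::], [::])) v.

Lemma nf_brun v o :
  brun v o = if nf v is Some (C, B) then brun (closes C ++ opens B) o else None.
Proof.
elim: v => //= -[b i] v ->; case: (nf v) => [[C B]|] /=; last by rewrite bstep_None.
case: b => //=; case: C => [|j C] //=; rewrite /bstep /=.
by case: eqP => [->|/eqP/negPf ne]; case: (brun _ _) => [s|] //=; rewrite ?eqxx ?ne.
Qed.

Fixpoint strip (p s : seq nat) : option (seq nat) :=
  match p, s with
  | [::], _ => Some s
  | c :: p', d :: s' => if d == c then strip p' s' else None
  | _, _ => None
  end.

Lemma strip_cat p s r : strip p s = Some r -> s = p ++ r.
Proof. by elim: p s => [|c p IH] [|d s] //= => [[]|[]|]; last by case: eqP => // -> /IH ->. Qed.

Lemma opens_closesK C o : brun (opens (rev C) ++ closes C) o = o.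
Proof.
elim: C o => //= c C IH o; rewrite rev_cons /opens map_rcons cat_rcons brun_cat /=.
by rewrite /bstep /= pop_pushK -brun_cat IH.
Qed.

(** At the first position where the two sequences differ, a wrong symbol is popped, whatever the
    stack below. In [star_wordP] this kills two consecutive copies of a word. *)
Lemma opens_closes_mismatch D C o : strip C D = None -> strip D C = None ->
  brun (opens (rev D) ++ closes C) o = None.
Proof.
elim: D C o => [|d D IH] [|c C] o //=.
rewrite eq_sym rev_cons /opens map_rcons cat_rcons brun_cat /= /bstep /=.
case: eqP => [->|ne H1 H2]; first by rewrite pop_pushK -brun_cat; apply: IH.
case: (brun (closes C) o) => [s|] /=; last exact: brun_None.
by case: eqP => // _; apply: brun_None.
Qed.

(* The word [star_word n v], if any, acts like [n] copies of [v]: if [v] reduces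
   to [closes C ++ opens B] and [opens B ++ closes C] to the word [z], which
   consists of opening letters only or of closing letters only, then [v] is the
   conjugate of [z] by the shorter of [C] and [B]. *)
Definition star_word (n : nat) (v : seq nlet) : option (seq nlet) :=
  if n is 0 then Some [::] else
  if nf v is Some (C, B) then
    if n == 1 then Some (closes C ++ opens B) else
    if strip C (rev B) is Some r then
      Some (closes C ++ flatten (nseq n (opens (rev r))) ++ opens (rev C))
    else if strip (rev B) C is Some r then
      Some (closes (rev B) ++ flatten (nseq n (closes r)) ++ opens B)
    else None
  else None.

(** Between neighbouring copies, [opens (rev C)] cancels the [closes C] that follows it. *)
Lemma brun_conjugate C z n o :
  brun (flatten (nseq n.+1 (closes C ++ z ++ opens (rev C)))) o =
  brun (closes C ++ flatten (nseq n.+1 z) ++ opens (rev C)) o.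
Proof.
elim: n => [|n IH]; first by rewrite /= !cats0.
have -> (w : seq nlet) : flatten (nseq n.+2 w) = w ++ flatten (nseq n.+1 w) by [].
by rewrite brun_cat IH !brun_cat -[brun (opens _) (brun (closes _) _)]brun_cat opens_closesK.
Qed.

Lemma star_wordP n v o : brun (flatten (nseq n v)) o =
  if star_word n v is Some w then brun w o else None.
Proof.
case: n => [|n]; rewrite /star_word //.
have := nf_brun v; case: (nf v) => [[C B]|] E; last by rewrite /= brun_cat E.
case: n => [|n] /=; first by rewrite cats0 E.
rewrite -[v ++ _]/(flatten (nseq n.+2 v)) (brun_flatten _ _ E).
case E1: (strip C (rev B)) => [r|].
  have EB : B = rev r ++ rev C by rewrite -rev_cat -(strip_cat E1) revK.
  by rewrite EB /opens map_cat -!/(opens _) brun_conjugate.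
case E2: (strip (rev B) C) => [r|].
  have EC : C = rev B ++ r := strip_cat E2.
  have -> : closes C ++ opens B = closes (rev B) ++ closes r ++ opens (rev (rev B)).
    by rewrite revK catA /closes -map_cat -EC.
  by rewrite brun_conjugate revK.
rewrite /= !brun_cat -[brun (opens B) (brun (closes C) _)]brun_cat -{1}[B]revK.
by rewrite opens_closes_mismatch // brun_None.
Qed.

(** * Words as relations between elements of a model *)

Definition letter_rel (M : euf_model) (a : nlet) (x y : dom M) : Prop :=
  if a.1 then x = un a.2.+1 y else un a.2.+1 x = y.

Fixpoint word_rel (M : euf_model) (w : seq nlet) (x y : dom M) : Prop :=
  if w is a :: w' then exists2 z, letter_rel a x z & word_rel w' z y else x = y.

Lemma word_rel_cat M w1 w2 (x y : dom M) :
  word_rel (w1 ++ w2) x y <-> exists2 z, word_rel w1 x z & word_rel w2 z y.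
Proof.
elim: w1 x => [|a w1 IH] x /=; first by split=> [|[z ->]]; [exists x|].
split=> [[z Hz /IH[t H1 H2]]|[t [z Hz H1] H2]].
  by exists t => //; exists z.
by exists z => //; apply/IH; exists t.
Qed.

Definition apply_fun (M : euf_model) (s : seq nat) (x : dom M) : dom M :=
  foldr (fun i => un i.+1) x s.

Lemma apply_fun_cat M s1 s2 (x : dom M) :
  apply_fun (s1 ++ s2) x = apply_fun s1 (apply_fun s2 x).
Proof. exact: foldr_cat. Qed.

Lemma apply_fun_iter M s n (x : dom M) :
  apply_fun (flatten (nseq n s)) x = iter n (apply_fun s) x.
Proof. by elim: n => //= n IH; rewrite apply_fun_cat IH. Qed.

Lemma closes_rel M C (x y : dom M) : word_rel (closes C) x y <-> apply_fun (rev C) x = y.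
Proof.
elim: C x => //= c C IH x; rewrite rev_cons -cats1 apply_fun_cat /=.
by split=> [[z <- /IH]|H]; [|exists (un c.+1 x); last apply/IH].
Qed.

Lemma opens_rel M B (x y : dom M) : word_rel (opens B) x y <-> x = apply_fun B y.
Proof.
elim: B x => //= b B IH x; split=> [[z -> /IH ->] //|->].
by exists (apply_fun B y); last apply/IH.
Qed.

(** The stack records the functions still to be applied to [x], and an opening letter discharges one
    of them. Only congruence is used, so this holds in every model; for an empty stack it reads
    [x = y]. *)
Lemma word_rel_brun M w s (x y : dom M) : brun w (Some [::]) = Some s ->
  word_rel w x y -> apply_fun (rev s) x = y.
Proof.
elim: w s x => [|[b i] w IH] s x /=; first by case=> <-.
rewrite /bstep /letter_rel /=; case: b => [/push_popK|].
  by move=> /IH{}IH [z ->] /IH <-; rewrite rev_cons -cats1 apply_fun_cat.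
case: (brun _ _) IH => // t IH [<-] [z <-] /(IH _ _ erefl) <-.
by rewrite rev_cons -cats1 apply_fun_cat.
Qed.

(** [NPow] is the only unary application of the term language, so a plain application is a power
    with exponent 1. *)
Definition one : lin := Lin 1 [::].
Definition loop_var (j : nat) : lin := Lin 0 [:: (1%R, j)].

Lemma lin_val_one sigma : lin_val sigma one = 1%R.
Proof. by rewrite /lin_val big_nil addr0. Qed.

Lemma lin_val_loop sigma j : lin_val sigma (loop_var j) = sigma j.
Proof. by rewrite /lin_val big_seq1 add0r mul1r. Qed.

(* The symbol 0 and the variables 0, 1, 2 serve to test whether a loop count is
   0, 1 or at least 2; the letters of kind [i] get the symbol [i + 1]. *)
Definition pow (s : seq nat) (t : eufn_term) : eufn_term := NPow (map succn s) one t.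

Definition loop_pow (s : seq nat) (j : nat) (t : eufn_term) : eufn_term :=
  NPow (map succn s) (loop_var j) t.

Definition letter_eq (a : nlet) (x y : eufn_term) : formula eufn_term :=
  if a.1 then FEq x (pow [:: a.2] y) else FEq (pow [:: a.2] x) y.

(** Without a normal form the loop taken once rules out a Dyck word; the equation is then trivial,
    so as not to constrain the models. *)
Definition once_eq (v : seq nlet) (x y : eufn_term) : formula eufn_term :=
  if nf v is Some (C, B) then FEq (pow (rev C) x) (pow B y) else FEq x x.

(** These equations spell out [star_word] with the loop count in the exponent: in one case
    [B = rev r ++ rev C], in the other [C = rev B ++ r], and the repeated part is [r]. *)
Definition many_eq (v : seq nlet) (j : nat) (x y : eufn_term) : formula eufn_term :=
  if nf v is Some (C, B) then
    if strip C (rev B) is Some r then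
      FEq (pow (rev C) x) (loop_pow (rev r) j (pow (rev C) y))
    else if strip (rev B) C is Some r then
      FEq (loop_pow (rev r) j (pow B x)) (pow B y)
    else FEq x x
  else FEq x x.

Definition if_count (j m : nat) (phi : formula eufn_term) : formula eufn_term :=
  FOr (FNot (FEq (NPow [:: 0] (loop_var j) (NVar 0)) (NVar m))) phi.

Definition loop_eq (v : seq nlet) (j : nat) (x y : eufn_term) : formula eufn_term :=
  FAnd (if_count j 0 (FEq x y))
    (FAnd (if_count j 1 (once_eq v x y)) (if_count j 2 (many_eq v j x y))).

Definition item_eq (it : item nlet) (j i : nat) : formula eufn_term :=
  match it with
  | inl a => letter_eq a (NVar (3 + i)) (NVar (4 + i))
  | inr v => loop_eq v j (NVar (3 + i)) (NVar (4 + i))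
  end.

Definition counters : formula eufn_term :=
  FAnd (FEq (NPow [:: 0] one (NVar 0)) (NVar 1))
    (FAnd (FEq (NPow [:: 0] one (NVar 1)) (NVar 2))
       (FEq (NPow [:: 0] one (NVar 2)) (NVar 2))).

Definition encode_step (s : nat * (nat * formula eufn_term)) (it : item nlet) :
    nat * (nat * formula eufn_term) :=
  (s.1.+1, (match it with inl _ => s.2.1 | inr _ => s.2.1.+1 end,
            FAnd s.2.2 (item_eq it s.2.1 s.1))).

(** Item number i links the variables [3 + i] and [4 + i]. The trivial equation makes variable 3
    occur even if there are no items, when it is both source and target. *)
Definition encode_items (l : seq (item nlet)) : st_formula :=
  let s := foldl encode_step (0, (0, FAnd counters (FEq (NVar 3) (NVar 3)))) l in
  StFormula s.2.2 3 (3 + s.1).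

(** * Truth of the encoding in a fixed model *)

Section Semantics.
Variables (M : euf_model) (rho : nat -> dom M) (sigma : nat -> nat).
Local Notation holds phi := (sat rho (subst sigma phi)).
Local Notation value t := (eval_euf rho (subst_term sigma t)).

Lemma eval_apply_comp fs t : eval_euf rho (apply_comp fs t) = foldr (@un M) (eval_euf rho t) fs.
Proof. by elim: fs => //= f fs ->. Qed.

Lemma value_pow s t : value (pow s t) = apply_fun s (value t).
Proof. by rewrite /= lin_val_one /= eval_apply_comp /apply_fun foldr_map. Qed.

Lemma value_loop_pow s j t : value (loop_pow s j t) = iter (sigma j) (apply_fun s) (value t).
Proof.
rewrite /= lin_val_loop absz_nat; elim: (sigma j) => //= n <-.
by rewrite eval_apply_comp /apply_fun foldr_map.
Qed.

Definition loop_case (n : nat) (v : seq nlet) (j : nat) (x y : eufn_term) :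
    formula eufn_term :=
  match n with 0 => FEq x y | 1 => once_eq v x y | _ => many_eq v j x y end.

Lemma loop_case_rel v j x y :
  holds (loop_case (sigma j) v j x y) <->
  if star_word (sigma j) v is Some w then word_rel w (value x) (value y) else True.
Proof.
move: (value_pow) (value_loop_pow) => Hp Hl.
case En: (sigma j) => [|[|n]] //.
  rewrite /loop_case /once_eq /star_word; case: (nf v) => [[C B]|] //=.
  rewrite -/(value (pow _ _)) -/(value (pow _ y)) !Hp word_rel_cat.
  split=> [H|[z /closes_rel <- /opens_rel]] //.
  by exists (apply_fun (rev C) (value x)); [apply/closes_rel | apply/opens_rel].
rewrite /loop_case /many_eq /star_word; case: (nf v) => [[C B]|] //.
rewrite -[n.+2 == 1]/false.
have flat_closes r : flatten (nseq n.+2 (closes r)) = closes (flatten (nseq n.+2 r)).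
  by rewrite /closes map_flatten map_nseq.
have flat_opens r : flatten (nseq n.+2 (opens r)) = opens (flatten (nseq n.+2 r)).
  by rewrite /opens map_flatten map_nseq.
case: (strip C _) => [r|].
  rewrite /sat /subst -/subst_term Hl !Hp En flat_opens !word_rel_cat.
  split=> [H|[z /closes_rel <- /word_rel_cat[t /opens_rel H1 /opens_rel H2]]].
    exists (apply_fun (rev C) (value x)); first exact/closes_rel.
    apply/word_rel_cat; exists (apply_fun (rev C) (value y)); apply/opens_rel => //.
    by rewrite apply_fun_iter.
  by rewrite H1 H2 apply_fun_iter.
case: (strip _ C) => [r|//].
rewrite /sat /subst -/subst_term Hl !Hp En flat_closes !word_rel_cat.
have rev_flat : rev (flatten (nseq n.+2 r)) = flatten (nseq n.+2 (rev r)).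
  by rewrite rev_flatten map_nseq rev_nseq.
split=> [H|[z /closes_rel H1 /word_rel_cat[t /closes_rel H2 /opens_rel H3]]].
  exists (apply_fun B (value x)); first by apply/closes_rel; rewrite revK.
  apply/word_rel_cat; exists (apply_fun B (value y)); last exact/opens_rel.
  by apply/closes_rel; rewrite rev_flat apply_fun_iter.
by rewrite -H3 -H2 -H1 revK rev_flat apply_fun_iter.
Qed.


Lemma value_count j : value (NPow [:: 0] (loop_var j) (NVar 0)) = iter (sigma j) (un 0) (rho 0).
Proof. by rewrite /= lin_val_loop absz_nat; elim: (sigma j) => //= n <-. Qed.

Lemma holds_counters : holds counters <->
  [/\ un 0 (rho 0) = rho 1, un 0 (rho 1) = rho 2 & un 0 (rho 2) = rho 2].
Proof. by rewrite /= lin_val_one /=; split=> [[? []]|[]]. Qed.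

Lemma iter_counter n : holds counters -> iter n (un 0) (rho 0) = rho (minn n 2).
Proof.
case/holds_counters => H0 H1 H2; case: n => [|[|n]] //.
have -> : minn n.+2 2 = 2 by [].
by elim: n => [|n IH]; rewrite iterS ?IH //= H0 H1.
Qed.

Lemma holds_if_count j m phi : holds (if_count j m phi) <->
  (iter (sigma j) (un 0) (rho 0) <> rho m \/ holds phi).
Proof. by rewrite -value_count. Qed.

(** An implication only: a model may identify the variables 0, 1, 2, and [loop_eq] then asks for
    more than the case at hand. This does no harm to soundness, and the stack model keeps the three
    apart. *)
Lemma loop_eq_case v j x y : holds counters -> holds (loop_eq v j x y) ->
  holds (loop_case (sigma j) v j x y).
Proof.
move=> Hc [H0 [H1 H2]].
have := (holds_if_count j 0 (FEq x y)).1 H0; have := (holds_if_count j 1 (once_eq v x y)).1 H1.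
have := (holds_if_count j 2 (many_eq v j x y)).1 H2; move=> {H0 H1 H2}; rewrite !(iter_counter _ Hc).
by case: (sigma j) => [|[|n]] H2 H1 H0; [case: H0 | case: H1 | case: H2].
Qed.

Fixpoint items_hold (j i : nat) (l : seq (item nlet)) : Prop :=
  if l is it :: l' then
    holds (item_eq it j i) /\
    items_hold (if it is inl _ then j else j.+1) i.+1 l'
  else True.

Lemma letter_eq_rel a x y : holds (letter_eq a x y) <-> letter_rel a (value x) (value y).
Proof. by rewrite /letter_eq /letter_rel; case: a.1; rewrite /sat /subst -/subst_term value_pow. Qed.

Lemma brun_words it j l o : brun (words sigma j (it :: l)) o =
  match it with
  | inl a => bstep a (brun (words sigma j l) o)
  | inr v => brun (flatten (nseq (sigma j) v)) (brun (words sigma j.+1 l) o)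
  end.
Proof. by case: it => [a|v] //; rewrite -brun_cat. Qed.

(** The formulas know a loop power only through [star_word], so the relation is obtained for a word
    [w] with the same action as the unrolled word; if some power has no such word, the unrolled word
    fails on every stack. *)
Lemma items_hold_rel j i l : holds counters -> items_hold j i l ->
  (forall o, brun (words sigma j l) o = None) \/
  exists2 w, (forall o, brun w o = brun (words sigma j l) o)
    & word_rel w (rho (3 + i)) (rho (3 + (i + size l))).
Proof.
move=> Hc; elim: l j i => [|it l IH] j i; first by right; exists [::]; rewrite /= ?addn0.
case=> Hit /IH[D|[w Ew Rw]].
  left=> o; rewrite brun_words; case: it {Hit} D => [a|v] D; rewrite D.
    exact: bstep_None.
  exact: brun_None.
rewrite [i.+1 + _]addSnnS in Rw; case: it Hit Ew => [a|v] Hit Ew.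
  right; exists (a :: w); first by move=> o; rewrite /= Ew.
  by exists (rho (3 + i.+1)) => //; move/letter_eq_rel: Hit; rewrite addnS.
move/(loop_eq_case Hc)/loop_case_rel: Hit; have := star_wordP (sigma j) v.
case: (star_word _ _) => [u|] Eu Ru.
  right; exists (u ++ w); first by move=> o; rewrite !brun_cat Ew Eu.
  by apply/word_rel_cat; exists (rho (3 + i.+1)) => //; rewrite addnS.
by left=> o; rewrite brun_cat Eu.
Qed.

Lemma holds_encode_step j i phi l :
  let s := foldl encode_step (i, (j, phi)) l in
  (holds s.2.2 <-> holds phi /\ items_hold j i l) /\ s.1 = i + size l.
Proof.
elim: l i j phi => [|it l IH] i j phi /=; first by rewrite addn0; split=> //; tauto.
rewrite /encode_step /=; have [H ->] := IH i.+1 (if it is inl _ then j else j.+1) (FAnd phi (item_eq it j i)).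
by split; [rewrite H /=; tauto | rewrite addSnnS].
Qed.

Lemma holds_encode_items l :
  holds (psi (encode_items l)) <-> holds counters /\ items_hold 0 0 l.
Proof.
rewrite /encode_items /=.
have [-> _] := holds_encode_step 0 0 (FAnd counters (FEq (NVar 3) (NVar 3))) l.
by rewrite /=; tauto.
Qed.

End Semantics.

Lemma target_encode_items l : target (encode_items l) = 3 + size l.
Proof.
(* The position reached does not depend on the model; a one-point model instantiates the lemma. *)
have [_ /= E] := @holds_encode_step (EufModel (fun=> id) (fun _ => head tt)) (fun=> tt)
  (fun=> 0) 0 0 (FAnd counters (FEq (NVar 3) (NVar 3))) l.
by rewrite /= E add0n.
Qed.

Lemma encode_items_sound sigma l : brun (words sigma 0 l) (Some [::]) = Some [::] ->
  entails_eq (subst sigma (psi (encode_items l))) (source (encode_items l))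
    (target (encode_items l)).
Proof.
move=> H M rho /holds_encode_items[Hc Hl]; rewrite target_encode_items.
have [D|[w Ew Rw]] := items_hold_rel Hc Hl; first by rewrite D in H.
by apply: (word_rel_brun (s := [::]) _ Rw); rewrite Ew.
Qed.

(* Terms denote stacks, or [None]; the symbol of an opening letter pops. *)
Definition stack_model : euf_model :=
  EufModel (dom := option (seq nat))
    (fun f => if f is i.+1 then pop i
              else fun o => if o is Some [::] then Some [:: 0] else Some [:: 0; 0])
    (fun _ => head None).

(** Position i denotes the stack left by the part of the unrolled word from item i on; the variables
    0, 1, 2 denote three distinct stacks. *)
Definition stack_assignment (sigma : nat -> nat) (l : seq (item nlet)) (x : nat) :
    dom stack_model :=
  match x with
  | 0 => Some [::]
  | 1 => Some [:: 0]
  | 2 => Some [:: 0; 0]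
  | i.+3 => brun (words sigma (nloops (take i l)) (drop i l)) (Some [::])
  end.

Lemma stack_word_rel w y : @word_rel stack_model w (brun w y) y.
Proof.
elim: w => //= -[b i] w IH; exists (brun w y) => //; rewrite /letter_rel /bstep /=.
by case: b; rewrite ?pop_pushK.
Qed.

Lemma stack_assignment_drop sigma l1 l2 i : i = size l1 ->
  stack_assignment sigma (l1 ++ l2) (3 + i) = brun (words sigma (nloops l1) l2) (Some [::]).
Proof. by move=> ->; rewrite /= take_size_cat // drop_size_cat. Qed.

Lemma stack_counters sigma l : sat (stack_assignment sigma l) (subst sigma counters).
Proof. exact/holds_counters. Qed.

Lemma stack_items_hold sigma l1 l2 :
  items_hold (stack_assignment sigma (l1 ++ l2)) sigma (nloops l1) (size l1) l2.
Proof.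
elim: l2 l1 => //= it l2 IH l1; split; last first.
  have := IH (rcons l1 it); rewrite cat_rcons size_rcons -cats1 nloops_cat.
  by case: it => [a|v] /=; rewrite ?addn0 ?addn1.
have Ex : stack_assignment sigma (l1 ++ it :: l2) (3 + size l1) =
    brun (words sigma (nloops l1) (it :: l2)) (Some [::]).
  exact: stack_assignment_drop.
have Ey : stack_assignment sigma (l1 ++ it :: l2) (4 + size l1) =
    brun (words sigma (nloops (rcons l1 it)) l2) (Some [::]).
  by rewrite -cat_rcons; apply: (@stack_assignment_drop _ _ _ (size l1).+1); rewrite size_rcons.
rewrite brun_words in Ex; rewrite -cats1 nloops_cat in Ey.
case: it Ex Ey => [a|v] Ex Ey.
  apply/letter_eq_rel; rewrite [eval_euf _ _]Ex [X in letter_rel _ _ X]Ey addn0.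
  have [z Hz Ez] := @stack_word_rel [:: a] (brun (words sigma (nloops l1) l2) (Some [::])).
  by rewrite -[X in letter_rel _ _ X]Ez.
set rho := stack_assignment _ _ in Ex Ey *.
have Hcase : sat rho (subst sigma (loop_case (sigma (nloops l1)) v (nloops l1)
    (NVar (3 + size l1)) (NVar (4 + size l1)))).
  have Vx : eval_euf rho (subst_term sigma (NVar (3 + size l1))) = _ := Ex.
  have Vy : eval_euf rho (subst_term sigma (NVar (4 + size l1))) = _ := Ey.
  apply/loop_case_rel; rewrite Vx Vy addn1.
  rewrite star_wordP; case: (star_word _ _) => // w; exact: stack_word_rel.
(* The counter stacks being distinct, the guard fails in all cases but the actual one. *)
have Hne m : m != minn (sigma (nloops l1)) 2 -> m <= 2 ->
    iter (sigma (nloops l1)) (@un stack_model 0) (rho 0) <> rho m.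
  rewrite (iter_counter _ (stack_counters sigma (l1 ++ inr v :: l2))).
  by have : minn (sigma (nloops l1)) 2 <= 2; [exact: geq_minr|];
    case: (minn _ _) m => [|[|[]]] // [|[|[]]].
by split; [|split]; apply/holds_if_count; move: Hcase;
  case: (sigma (nloops l1)) Hne => [|[|n]] Hne H;
  first [by right | by left; apply: Hne].
Qed.

(** In the stack model the source denotes the result of running the whole word and the target the
    empty stack. *)
Lemma encode_items_complete sigma l :
  entails_eq (subst sigma (psi (encode_items l))) (source (encode_items l))
    (target (encode_items l)) -> brun (words sigma 0 l) (Some [::]) = Some [::].
Proof.
move=> /(_ stack_model (stack_assignment sigma l)).
rewrite target_encode_items => H.
have {}H := H ((holds_encode_items _ _ _).2
  (conj (stack_counters sigma l) (stack_items_hold sigma [::] l))).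
by move: H; rewrite /= drop0 take0 drop_size take_size.
Qed.

(** A syntactic condition that ensures nonnegative exponents for all loop counts and variables in
    range. *)
Definition good_lin (q : nat) (e : lin) : bool :=
  (0 <= lin_const e)%R && all (fun c => (0 <= c.1)%R && (c.2 < q)) (lin_coefs e).

Lemma good_lin_ge0 q e sigma : good_lin q e -> (0 <= lin_val sigma e)%R.
Proof.
case/andP=> He /allP Hc; apply: addr_ge0 => //; rewrite big_seq.
by apply: sumr_ge0 => c /Hc/andP[Hc1 _]; apply: mulr_ge0.
Qed.

Lemma exponents_and phi1 phi2 : exponents (FAnd phi1 phi2) = exponents phi1 ++ exponents phi2.
Proof. by rewrite /exponents /= map_cat flatten_cat. Qed.

Lemma exponents_or phi1 phi2 : exponents (FOr phi1 phi2) = exponents phi1 ++ exponents phi2.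
Proof. by rewrite /exponents /= map_cat flatten_cat. Qed.

Lemma u_vars_and phi1 phi2 : u_vars (FAnd phi1 phi2) = u_vars phi1 ++ u_vars phi2.
Proof. by rewrite /u_vars /= map_cat flatten_cat. Qed.

Lemma u_vars_or phi1 phi2 : u_vars (FOr phi1 phi2) = u_vars phi1 ++ u_vars phi2.
Proof. by rewrite /u_vars /= map_cat flatten_cat. Qed.

Lemma item_eq_exponents it j i q : (if it is inr _ then j < q else true) ->
  all (good_lin q) (exponents (item_eq it j i)).
Proof.
case: it => [a _|v jq].
  by rewrite /= /letter_eq; case: a.1.
rewrite /item_eq /loop_eq /if_count !exponents_and !exponents_or !all_cat.
have H x : all (good_lin q) (exponents (FNot (FEq (NPow [:: 0] (loop_var j) (NVar 0)) (NVar x)))).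
  by rewrite /= /good_lin /= jq.
rewrite !H /= /once_eq /many_eq; case: (nf v) => [[C B]|] //.
case: (strip C _) => [r|]; first by rewrite /= /good_lin /= jq.
by case: (strip _ C) => [r|] //; rewrite /= /good_lin /= jq.
Qed.

Lemma item_eq_u_vars it j i : 4 + i \in u_vars (item_eq it j i).
Proof.
case: it => [a|v]; first by rewrite /item_eq /letter_eq; case: a.1; rewrite !inE eqxx ?orbT.
rewrite /item_eq /loop_eq u_vars_and mem_cat; apply/orP; left.
by rewrite /if_count u_vars_or mem_cat; apply/orP; right; rewrite !inE eqxx orbT.
Qed.

Lemma encode_step_exponents q l i j phi :
  all (good_lin q) (exponents phi) -> j + nloops l <= q ->
  all (good_lin q) (exponents (foldl encode_step (i, (j, phi)) l).2.2).
Proof.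
elim: l i j phi => //= it l IH i j phi Hphi Hq.
rewrite /encode_step /=; apply: IH; last by case: it Hq => //= v; rewrite addnS.
rewrite exponents_and all_cat Hphi /= item_eq_exponents //.
by case: it Hq => //= v; lia.
Qed.

Lemma encode_step_u_vars l i j phi :
  3 \in u_vars phi -> 3 + i \in u_vars phi ->
  let s := foldl encode_step (i, (j, phi)) l in
  (3 \in u_vars s.2.2) && (3 + s.1 \in u_vars s.2.2).
Proof.
elim: l i j phi => /= [|it l IH] i j phi H3 Hi; first by rewrite H3.
apply: IH; rewrite u_vars_and mem_cat ?H3 //; apply/orP; right; exact: item_eq_u_vars.
Qed.

Lemma all_flatten T (p : pred T) (ss : seq (seq T)) : all p (flatten ss) = all (all p) ss.
Proof. by elim: ss => //= s ss IH; rewrite all_cat IH. Qed.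

Lemma encode_items_expresses l : expresses (nloops l) (encode_items l)
  (fun sigma => brun (words sigma 0 l) (Some [::]) = Some [::]).
Proof.
have He : all (good_lin (nloops l)) (exponents (psi (encode_items l))).
  exact: encode_step_exponents.
have /andP[Hs Ht] : (source (encode_items l) \in u_vars (psi (encode_items l))) &&
    (target (encode_items l) \in u_vars (psi (encode_items l))).
  by apply: encode_step_u_vars.
split=> // [|sigma].
  rewrite /n_vars all_flatten all_map; apply: sub_all He => e /andP[_ Hc] /=.
  by rewrite all_map; apply: sub_all Hc => c /andP[].
split; first by apply: sub_all He => e; apply: good_lin_ge0.
by split; [apply: encode_items_sound | apply: encode_items_complete].
Qed.

(** * Computable functions *)

Class Code (A : Type) := code : A -> tree.

#[export] Instance code_tree_inst : Code tree := id.
#[export] Instance code_nat_inst : Code nat := code_nat.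
#[export] Instance code_bool_inst : Code bool := code_bool.
#[export] Instance code_pair_inst A B {cA : Code A} {cB : Code B} : Code (A * B) :=
  fun p => Cons (code p.1) (code p.2).
#[export] Instance code_seq_inst A {cA : Code A} : Code (seq A) := code_seq code.
#[export] Instance code_sum_inst A B {cA : Code A} {cB : Code B} : Code (A + B) :=
  fun s => match s with
           | inl a => Cons Nil (code a)
           | inr b => Cons (Cons Nil Nil) (code b)
           end.
#[export] Instance code_option_inst A {cA : Code A} : Code (option A) :=
  fun o => if o is Some a then Cons Nil (code a) else Nil.
#[export] Instance code_unit_inst : Code unit := fun=> Nil.

Definition computable A B {cA : Code A} {cB : Code B} (f : A -> B) : Prop :=
  exists c, forall a, exec c (code a) (code (f a)).

(** * Building blocks of WHILE programs *)

Fixpoint expr_on (g e : expr) : expr :=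
  match e with
  | EX => g
  | ENil => ENil
  | ECons e1 e2 => ECons (expr_on g e1) (expr_on g e2)
  | EHd e1 => EHd (expr_on g e1)
  | ETl e1 => ETl (expr_on g e1)
  end.

Lemma eval_expr_on g e x :
  eval_expr (expr_on g e) x = eval_expr e (eval_expr g x).
Proof. by elim: e => //= [e1 -> e2 ->|e1 ->|e1 ->]. Qed.

(** As programs have a single variable, data to be saved during a run of [c] are kept in the right
    component of a pair. *)
Fixpoint on_hd (c : cmd) : cmd :=
  match c with
  | Assign e => Assign (ECons (expr_on (EHd EX) e) (ETl EX))
  | Seq c1 c2 => Seq (on_hd c1) (on_hd c2)
  | While e c1 => While (expr_on (EHd EX) e) (on_hd c1)
  end.

Lemma exec_on_hd c x y z : exec c x y -> exec (on_hd c) (Cons x z) (Cons y z).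
Proof.
elim=> /= [e t|c1 c2 t u v _ IH1 _ IH2|e c1 t H|e c1 t u v H _ IH1 _ IH2].
- have -> : Cons (eval_expr e t) z =
    eval_expr (ECons (expr_on (EHd EX) e) (ETl EX)) (Cons t z).
    by rewrite /= eval_expr_on.
  exact: exec_assign.
- exact: exec_seq IH1 IH2.
- by apply: exec_while_end; rewrite eval_expr_on.
- by apply: exec_while_step IH1 IH2; rewrite eval_expr_on.
Qed.

Lemma exec_assign_eq e x y : eval_expr e x = y -> exec (Assign e) x y.
Proof. by move=> <-; apply: exec_assign. Qed.

Definition on_tl (c : cmd) : cmd :=
  Seq (Assign (ECons (ETl EX) (EHd EX)))
    (Seq (on_hd c) (Assign (ECons (ETl EX) (EHd EX)))).

Lemma exec_on_tl c x y z : exec c x y -> exec (on_tl c) (Cons z x) (Cons z y).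
Proof.
move=> H; apply: (exec_seq (exec_assign _ _)) => /=.
apply: (exec_seq (exec_on_hd _ H)).
exact: exec_assign_eq.
Qed.

(** A conditional made of two loops that run at most once each. Next to the test an else flag is
    set; a branch clears both after its run, so that neither loop is entered again. *)
Definition if_cmd (c1 c2 : cmd) : cmd :=
  Seq (Assign (ECons (EHd EX) (ECons (ECons ENil ENil) (ETl EX))))
  (Seq (While (EHd EX)
         (Seq (on_tl (on_tl c1)) (Assign (ECons ENil (ECons ENil (ETl (ETl EX)))))))
  (Seq (While (EHd (ETl EX))
         (Seq (on_tl (on_tl c2)) (Assign (ECons ENil (ECons ENil (ETl (ETl EX)))))))
       (Assign (ETl (ETl EX))))).

Lemma exec_if_true c1 c2 b x y :
  b <> Nil -> exec c1 x y -> exec (if_cmd c1 c2) (Cons b x) y.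
Proof.
move=> Hb H; apply: (exec_seq (exec_assign _ _)) => /=.
apply: exec_seq.
  apply: (@exec_while_step _ _ _ (Cons Nil (Cons Nil y))) => //=.
    apply: (exec_seq (exec_on_tl _ (exec_on_tl _ H))).
    exact: exec_assign_eq.
  exact: exec_while_end.
apply: exec_seq; first exact: exec_while_end.
exact: exec_assign_eq.
Qed.

Lemma exec_if_false c1 c2 x y :
  exec c2 x y -> exec (if_cmd c1 c2) (Cons Nil x) y.
Proof.
move=> H; apply: (exec_seq (exec_assign _ _)) => /=.
apply: exec_seq; first exact: exec_while_end.
apply: exec_seq.
  apply: (@exec_while_step _ _ _ (Cons Nil (Cons Nil y))) => //=.
    apply: (exec_seq (exec_on_tl _ (exec_on_tl _ H))).
    exact: exec_assign_eq.
  exact: exec_while_end.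
exact: exec_assign_eq.
Qed.

(** Case distinctions are functions here, so that the tactic below can recognise them. *)
Definition case_bool A (b : bool) (x y : A) : A := if b then x else y.

Definition case_seq A B (l : seq A) (b : B) (f : A -> seq A -> B) : B :=
  match l with [::] => b | a :: l' => f a l' end.

Definition case_option A B (o : option A) (b : B) (f : A -> B) : B :=
  if o is Some a then f a else b.

Definition case_sum A B C (s : A + B) (f : A -> C) (g : B -> C) : C :=
  match s with inl a => f a | inr b => g b end.

Fixpoint const_expr (t : tree) : expr :=
  if t is Cons a b then ECons (const_expr a) (const_expr b) else ENil.

Lemma eval_const_expr t x : eval_expr (const_expr t) x = t.
Proof. by elim: t => //= a -> b ->. Qed.

Section Closure.
Context {X : Type} {cX : Code X}.

Lemma computable_ext A {cA : Code A} (f g : X -> A) :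
  f =1 g -> computable f -> computable g.
Proof. by move=> E [c H]; exists c => x; rewrite -E. Qed.

(** Programs see only codes. Since a nonempty list, a successor or [Some] is coded as a pair, these
    constructors reduce to pairing. *)
Lemma computable_code A B {cA : Code A} {cB : Code B} (f : X -> A) (g : X -> B) :
  (forall x, code (g x) = code (f x)) -> computable f -> computable g.
Proof. by move=> E [c H]; exists c => x; rewrite E. Qed.

Lemma computable_comp A B {cA : Code A} {cB : Code B} (g : A -> B) (f : X -> A) :
  computable g -> computable f -> computable (fun x => g (f x)).
Proof.
by move=> [cg Hg] [cf Hf]; exists (Seq cf cg) => x; apply: exec_seq (Hf x) (Hg _).
Qed.

Lemma computable_id : computable (fun x : X => x).
Proof. by exists (Assign EX) => x; apply: exec_assign_eq. Qed.

Lemma computable_const A {cA : Code A} (a : A) : computable (fun _ : X => a).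
Proof.
by exists (Assign (const_expr (code a))) => x; apply: exec_assign_eq; rewrite eval_const_expr.
Qed.

Lemma computable_pair A B {cA : Code A} {cB : Code B} (f : X -> A) (g : X -> B) :
  computable f -> computable g -> computable (fun x => (f x, g x)).
Proof.
move=> [cf Hf] [cg Hg].
exists (Seq (Assign (ECons EX EX)) (Seq (on_hd cf) (on_tl cg))) => x.
apply: (exec_seq (exec_assign _ _)) => /=.
by apply: (exec_seq (exec_on_hd _ (Hf x))); apply: exec_on_tl.
Qed.

Lemma computable_fst A B {cA : Code A} {cB : Code B} (f : X -> A * B) :
  computable f -> computable (fun x => (f x).1).
Proof.
move=> [c H]; exists (Seq c (Assign (EHd EX))) => x.
by apply: (exec_seq (H x)); apply: exec_assign_eq.
Qed.

Lemma computable_snd A B {cA : Code A} {cB : Code B} (f : X -> A * B) :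
  computable f -> computable (fun x => (f x).2).
Proof.
move=> [c H]; exists (Seq c (Assign (ETl EX))) => x.
by apply: (exec_seq (H x)); apply: exec_assign_eq.
Qed.

Lemma computable_Cons (f g : X -> tree) :
  computable f -> computable g -> computable (fun x => Cons (f x) (g x)).
Proof. by move=> Hf Hg; apply: computable_code (computable_pair Hf Hg). Qed.

Lemma computable_tree A {cA : Code A} (f : X -> A) :
  computable f -> computable (fun x => code (f x)).
Proof. exact: computable_code. Qed.

Lemma computable_cons A {cA : Code A} (f : X -> A) (g : X -> seq A) :
  computable f -> computable g -> computable (fun x => f x :: g x).
Proof. by move=> Hf Hg; apply: computable_code (computable_pair Hf Hg). Qed.

Lemma computable_succ (f : X -> nat) :
  computable f -> computable (fun x => (f x).+1).
Proof.
by move=> Hf; apply: computable_code (computable_pair (computable_const tt) Hf).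
Qed.

Lemma computable_some A {cA : Code A} (f : X -> A) :
  computable f -> computable (fun x => Some (f x)).
Proof.
by move=> Hf; apply: computable_code (computable_pair (computable_const tt) Hf).
Qed.

Lemma computable_inl A B {cA : Code A} {cB : Code B} (f : X -> A) :
  computable f -> computable (fun x => inl (f x) : A + B)%type.
Proof.
by move=> Hf; apply: computable_code (computable_pair (computable_const Nil) Hf).
Qed.

Lemma computable_inr A B {cA : Code A} {cB : Code B} (f : X -> B) :
  computable f -> computable (fun x => inr (f x) : A + B)%type.
Proof.
by move=> Hf;
  apply: computable_code (computable_pair (computable_const (Cons Nil Nil)) Hf).
Qed.

Lemma computable_if A {cA : Code A} (b : X -> bool) (f g : X -> A) :
  computable b -> computable f -> computable g ->
  computable (fun x => case_bool (b x) (f x) (g x)).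
Proof.
move=> Hb [cf Hf] [cg Hg]; have [c Hc] := computable_pair Hb computable_id.
exists (Seq c (if_cmd cf cg)) => x; apply: (exec_seq (Hc x)).
rewrite /code /code_pair_inst /=; case: (b x); first by apply: exec_if_true.
exact: exec_if_false.
Qed.

Lemma computable_case_seq A B {cA : Code A} {cB : Code B} (l : X -> seq A) (f : X -> B)
    (g : X -> A -> seq A -> B) :
  computable l -> computable f ->
  computable (fun p : X * (A * seq A) => g p.1 p.2.1 p.2.2) ->
  computable (fun x => case_seq (l x) (f x) (g x)).
Proof.
move=> Hl [cf Hf] [cg Hg].
have [c Hc] := computable_pair Hl (computable_pair computable_id Hl).
exists (Seq c (if_cmd cg (Seq (Assign (EHd EX)) cf))) => x.
apply: (exec_seq (Hc x)); rewrite /code /code_pair_inst /=.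
case: (l x) => [|a l'].
  by apply: exec_if_false; apply: (exec_seq (exec_assign _ _)); apply: Hf.
by apply: exec_if_true => //; apply: (Hg (x, (a, l'))).
Qed.

Lemma computable_case_option A B {cA : Code A} {cB : Code B} (o : X -> option A)
    (f : X -> B) (g : X -> A -> B) :
  computable o -> computable f -> computable (fun p : X * A => g p.1 p.2) ->
  computable (fun x => case_option (o x) (f x) (g x)).
Proof.
move=> Ho [cf Hf] [cg Hg].
have [c Hc] := computable_pair Ho (computable_pair computable_id Ho).
exists (Seq c (if_cmd (Seq (Assign (ECons (EHd EX) (ETl (ETl EX)))) cg)
                 (Seq (Assign (EHd EX)) cf))) => x.
apply: (exec_seq (Hc x)); rewrite /code /code_pair_inst /=.
case: (o x) => [a|].
  by apply: exec_if_true => //; apply: (exec_seq (exec_assign _ _)); apply: (Hg (x, a)).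
by apply: exec_if_false; apply: (exec_seq (exec_assign _ _)); apply: Hf.
Qed.

Lemma computable_case_sum A B C {cA : Code A} {cB : Code B} {cC : Code C}
    (s : X -> A + B) (f : X -> A -> C) (g : X -> B -> C) :
  computable s -> computable (fun p : X * A => f p.1 p.2) ->
  computable (fun p : X * B => g p.1 p.2) ->
  computable (fun x => case_sum (s x) (f x) (g x)).
Proof.
move=> Hs [cf Hf] [cg Hg].
have [c Hc] := computable_pair Hs computable_id.
exists (Seq c (Seq (Assign (ECons (EHd (EHd EX)) (ECons (ETl EX) (ETl (EHd EX)))))
                 (if_cmd cg cf))) => x.
apply: (exec_seq (Hc x)); rewrite /code /code_pair_inst /=.
apply: (exec_seq (exec_assign _ _)) => /=.
case: (s x) => [a|b] /=; first by apply: exec_if_false; apply: (Hf (x, a)).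
by apply: exec_if_true => //; apply: (Hg (x, b)).
Qed.

Lemma computable_foldl A B {cA : Code A} {cB : Code B} (g : X -> B -> A -> B)
    (b : X -> B) (l : X -> seq A) :
  computable b -> computable l ->
  computable (fun p : X * (B * A) => g p.1 p.2.1 p.2.2) ->
  computable (fun x => foldl (g x) (b x) (l x)).
Proof.
move=> Hb Hl [cg Hg].
have [c Hc] := computable_pair Hl (computable_pair computable_id Hb).
pose e := ECons (EHd (EHd EX)) ENil.
pose body := Seq (Assign (ECons (ECons (EHd (ETl EX))
    (ECons (ETl (ETl EX)) (EHd (EHd EX)))) (ECons (ETl (EHd EX)) (EHd (ETl EX)))))
  (Seq (on_hd cg) (Assign (ECons (EHd (ETl EX)) (ECons (ETl (ETl EX)) (EHd EX))))).
have loop x l' : forall b',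
    exec (While (EHd EX) body) (code (l', (x, b'))) (code (([::] : seq A, (x, foldl (g x) b' l')))).
  elim: l' => [|a l' IH] b'; first exact: exec_while_end.
  apply: exec_while_step (IH _) => //.
  apply: (exec_seq (exec_assign _ _)) => /=.
  apply: (exec_seq (exec_on_hd _ (Hg (x, (b', a))))).
  exact: exec_assign_eq.
exists (Seq c (Seq (While (EHd EX) body) (Assign (ETl (ETl EX))))) => x.
apply: (exec_seq (Hc x)); apply: (exec_seq (loop _ _ _)).
exact: exec_assign_eq.
Qed.

End Closure.

(** A numeral is a list of units, so iteration is a fold over a list. *)
Lemma code_nat_nseq n : code n = code (nseq n tt).
Proof. by elim: n => // n IH; congr (Cons Nil _). Qed.

Lemma iter_foldl A (f : A -> A) n a :
  iter n f a = foldl (fun b (_ : unit) => f b) a (nseq n tt).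
Proof. by elim: n a => //= n IH a; rewrite -IH -iterSr. Qed.

Lemma computable_iter X A {cX : Code X} {cA : Code A} (f : X -> A -> A) (n : X -> nat)
    (a : X -> A) :
  computable n -> computable a -> computable (fun p : X * A => f p.1 p.2) ->
  computable (fun x => iter (n x) (f x) (a x)).
Proof.
move=> Hn Ha Hf.
apply: (@computable_ext _ _ _ _
  (fun x => foldl (fun b (_ : unit) => f x b) (a x) (nseq (n x) tt))).
  by move=> x; rewrite iter_foldl.
apply: (@computable_foldl _ _ _ _ _ _ (fun x b _ => f x b)) => //.
  apply: computable_code Hn => x; exact/esym/code_nat_nseq.
apply: (computable_comp (g := fun p : X * A => f p.1 p.2)
  (f := fun q => (q.1, q.2.1))) => //.
apply: computable_pair; first exact: computable_fst computable_id.
exact: computable_fst (computable_snd computable_id).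
Qed.

(** Primitive recursion on trees: the step sees the subtrees besides their results, which the
    decoding of constructor arguments requires. *)
Fixpoint para A (g : tree -> tree -> A -> A -> A) (a : A) (t : tree) : A :=
  if t is Cons l r then g l r (para g a l) (para g a r) else a.


Fixpoint elems (t : tree) : seq tree := if t is Cons a b then a :: elems b else [::].

Definition of_elems (s : seq tree) : tree := code_seq id s.

Lemma elemsK : cancel elems of_elems.
Proof. by rewrite /of_elems; elim=> //= a _ b ->. Qed.

Lemma computable_of_elems X {cX : Code X} (t : X -> seq tree) :
  computable t -> computable (fun x => of_elems (t x)).
Proof. exact: computable_code. Qed.

Lemma computable_elems X {cX : Code X} (t : X -> tree) :
  computable t -> computable (fun x => elems (t x)).
Proof. by apply: computable_code => x; exact: elemsK. Qed.

(** Termination of a task loop whose number of rounds is not known in advance. *)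
Inductive reaches (T U : Type) (step : seq T * U -> seq T * U) :
    seq T * U -> U -> Prop :=
  | reaches_nil u : reaches step ([::], u) u
  | reaches_step s u : s.1 <> [::] -> reaches step (step s) u -> reaches step s u.

Lemma exec_reaches T U {cT : Code T} {cU : Code U} (step : seq T * U -> seq T * U) :
  computable step ->
  exists c, forall s u, reaches step s u -> exec c (code s) (code u).
Proof.
move=> [c Hc]; exists (Seq (While (EHd EX) c) (Assign (ETl EX))) => s u R.
apply: (@exec_seq _ _ _ (code (([::] : seq T), u))); last exact: exec_assign_eq.
elim: R => {s u} [u|s u Hs _ IH]; first exact: exec_while_end.
by apply: exec_while_step (Hc s) IH; case: s Hs => [[]].
Qed.

Ltac computable_core :=
  lazymatch goal with
  | |- computable (fun x => x) => exact: computable_id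
  | |- computable (fun x => (@?f x, @?g x)) => apply: (@computable_pair _ _ _ _ _ _ f g)
  | |- computable (fun x => (@?f x).1) => apply: (@computable_fst _ _ _ _ _ _ f)
  | |- computable (fun x => (@?f x).2) => apply: (@computable_snd _ _ _ _ _ _ f)
  | |- computable (fun x => @?f x :: @?g x) => apply: (@computable_cons _ _ _ _ f g)
  | |- computable (fun x => (@?f x).+1) => apply: (@computable_succ _ _ f)
  | |- computable (fun x => Some (@?f x)) => apply: (@computable_some _ _ _ _ f)
  | |- computable (fun x => inl (@?f x)) => apply: (@computable_inl _ _ _ _ _ _ f)
  | |- computable (fun x => inr (@?f x)) => apply: (@computable_inr _ _ _ _ _ _ f)
  | |- computable (fun x => Cons (@?f x) (@?g x)) => apply: (@computable_Cons _ _ f g)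
  | |- computable (fun x => elems (@?f x)) => apply: (@computable_elems _ _ f)
  | |- computable (fun x => of_elems (@?f x)) => apply: (@computable_of_elems _ _ f)
  | |- computable (fun x => case_bool (@?b x) (@?f x) (@?g x)) =>
      apply: (@computable_if _ _ _ _ b f g)
  | |- computable (fun x => case_seq (@?l x) (@?f x) (@?g x)) =>
      apply: (@computable_case_seq _ _ _ _ _ _ l f g)
  | |- computable (fun x => case_option (@?l x) (@?f x) (@?g x)) =>
      apply: (@computable_case_option _ _ _ _ _ _ l f g)
  | |- computable (fun x => case_sum (@?l x) (@?f x) (@?g x)) =>
      apply: (@computable_case_sum _ _ _ _ _ _ _ _ l f g)
  | |- computable (fun x => foldl (@?g x) (@?b x) (@?l x)) =>
      apply: (@computable_foldl _ _ _ _ _ _ g b l)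
  | |- computable (fun x => iter (@?n x) (@?f x) (@?a x)) =>
      apply: (@computable_iter _ _ _ _ f n a)
  | |- computable (fun _ => ?a) => exact: computable_const
  end.

Ltac computable_eta :=
  lazymatch goal with
  | |- computable (fun _ => _) => idtac
  | |- computable ?f => change (computable (fun x => f x))
  end.

(* Extended below each time a function is shown to be computable. *)
Ltac computable_user := fail.
Ltac computability :=
  try assumption;
  repeat (cbv beta; try assumption; computable_eta; first [progress computable_core | computable_user
    | match goal with
      | H : computable ?f |- computable (fun x => ?f (@?g x)) =>
          apply: (@computable_comp _ _ _ _ _ _ f g H)
      end]); cbv beta.

(* The loop keeps a stack of tasks and a stack of values: evaluate a tree, or
   combine the top two values, which are the results for two subtrees. *)
Lemma computable_para X A {cX : Code X} {cA : Code A} (g : X -> tree -> tree -> A -> A -> A)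
    (a : X -> A) (t : X -> tree) :
  computable a -> computable t ->
  computable (fun p : X * ((tree * tree) * (A * A)) =>
    g p.1 p.2.1.1 p.2.1.2 p.2.2.1 p.2.2.2) ->
  computable (fun x => para (g x) (a x) (t x)).
Proof.
move=> Ha Ht Hg.
pose step (s : seq (tree + tree * tree) * ((X * A) * seq A)) :=
  case_seq s.1 s (fun k T =>
    case_sum k
      (fun t => case_seq (elems t) (T, (s.2.1, s.2.1.2 :: s.2.2))
        (fun l r => (inl l :: inl (of_elems r) :: inr (l, of_elems r) :: T, s.2)))
      (fun lr => case_seq s.2.2 s (fun vr vs =>
        case_seq vs s (fun vl vs' =>
          (T, (s.2.1, g s.2.1.1 lr.1 lr.2 vl vr :: vs')))))).
have Hstep : computable step.
  rewrite /step; computability.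
  apply: (computable_comp (g := fun p : X * ((tree * tree) * (A * A)) =>
    g p.1 p.2.1.1 p.2.1.2 p.2.2.1 p.2.2.2)
    (f := fun q => (q.1.1.1.1.2.1.1, (q.1.1.2, (q.2.1, q.1.2.1))))) => //.
  by computability.
have [c Hc] := exec_reaches Hstep.
(* Generalised over the pending tasks and values, so that the induction can treat the two subtrees
   in turn. *)
have reach x b u : forall T vs z, reaches step (T, ((x, b), para (g x) b u :: vs)) z ->
    reaches step (inl u :: T, ((x, b), vs)) z.
  elim: u => [|l IHl r IHr] T vs z R; apply: reaches_step => //.
  rewrite /step /= elemsK; apply: IHl; apply: IHr.
  exact: reaches_step.
have Hi : computable (fun x => ([:: inl (t x)] : seq (tree + tree * tree), ((x, a x), [::] : seq A))).
  by computability.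
have [ci Hci] := Hi.
exists (Seq ci (Seq c (Assign (EHd (ETl EX))))) => x.
apply: (exec_seq (Hci x)); apply: exec_seq.
  by apply: Hc; apply: reach; apply: reaches_nil.
exact: exec_assign_eq.
Qed.

(** * The encoding program *)

Lemma computable_hd X {cX : Code X} (t : X -> tree) : computable t -> computable (fun x => hd (t x)).
Proof.
move=> [c H]; exists (Seq c (Assign (EHd EX))) => x.
by apply: (exec_seq (H x)); apply: exec_assign_eq.
Qed.

Lemma computable_tl X {cX : Code X} (t : X -> tree) : computable t -> computable (fun x => tl (t x)).
Proof.
move=> [c H]; exists (Seq c (Assign (ETl EX))) => x.
by apply: (exec_seq (H x)); apply: exec_assign_eq.
Qed.

Lemma computable_pred X {cX : Code X} (n : X -> nat) : computable n -> computable (fun x => (n x).-1).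
Proof.
by move=> Hn; apply: computable_code (computable_tl (computable_tree Hn)) => x; case: (n x).
Qed.

Lemma computable_nseq X {cX : Code X} (n : X -> nat) : computable n -> computable (fun x => nseq (n x) tt).
Proof. by apply: computable_code => x; rewrite code_nat_nseq. Qed.

Lemma computable_iszero X {cX : Code X} (n : X -> nat) : computable n -> computable (fun x => n x == 0).
Proof.
move=> Hn; apply: (@computable_ext _ _ _ _ (fun x => case_seq (nseq (n x) tt) true (fun _ _ => false))).
  by move=> x; case: (n x).
by computability; apply: computable_nseq.
Qed.

Lemma computable_sub X {cX : Code X} (m n : X -> nat) :
  computable m -> computable n -> computable (fun x => m x - n x).
Proof.
move=> Hm Hn; apply: (@computable_ext _ _ _ _ (fun x => iter (n x) predn (m x))).
  by move=> x; elim: (n x) => [|k /= ->]; rewrite ?subn0 // subnS.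
by computability; apply: computable_pred; computability.
Qed.

Lemma computable_eqn X {cX : Code X} (m n : X -> nat) :
  computable m -> computable n -> computable (fun x => m x == n x).
Proof.
move=> Hm Hn; apply: (@computable_ext _ _ _ _
  (fun x => case_bool (m x - n x == 0) (n x - m x == 0) false)).
  by move=> x; rewrite [RHS]eqn_leq.
by computability; apply: computable_iszero; apply: computable_sub.
Qed.

Lemma computable_add X {cX : Code X} (m n : X -> nat) :
  computable m -> computable n -> computable (fun x => m x + n x).
Proof.
move=> Hm Hn; apply: (@computable_ext _ _ _ _ (fun x => iter (m x) succn (n x))).
  by move=> x; rewrite iter_succn addnC.
by computability.
Qed.

Lemma computable_catrev X {cX : Code X} A {cA : Code A} (s t : X -> seq A) :
  computable s -> computable t -> computable (fun x => catrev (s x) (t x)).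
Proof.
move=> Hs Ht.
apply: (@computable_ext _ _ _ _ (fun x => foldl (fun u a => a :: u) (t x) (s x))).
  by move=> x; elim: (s x) (t x) => //= a u IH v; rewrite IH.
by computability.
Qed.

Lemma computable_rev X {cX : Code X} A {cA : Code A} (s : X -> seq A) :
  computable s -> computable (fun x => rev (s x)).
Proof. by move=> Hs; apply: computable_catrev => //; apply: computable_const. Qed.

Lemma computable_foldr X A B {cX : Code X} {cA : Code A} {cB : Code B}
    (g : X -> A -> B -> B) (b : X -> B) (l : X -> seq A) :
  computable b -> computable l ->
  computable (fun p : X * (B * A) => g p.1 p.2.2 p.2.1) ->
  computable (fun x => foldr (g x) (b x) (l x)).
Proof.
move=> Hb Hl Hg.
apply: (@computable_ext _ _ _ _ (fun x => foldl (fun u a => g x a u) (b x) (rev (l x)))).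
  by move=> x; rewrite foldl_rev.
by apply: (@computable_foldl _ _ _ _ _ _ (fun x u a => g x a u)) => //; apply: computable_rev.
Qed.

Ltac computable_user ::=
  lazymatch goal with
  | |- computable (fun x => @?m x + @?n x) => apply: (@computable_add _ _ m n)
  | |- computable (fun x => foldr (@?g x) (@?b x) (@?l x)) =>
      apply: (@computable_foldr _ _ _ _ _ _ g b l)
  end.

Lemma computable_map X A B {cX : Code X} {cA : Code A} {cB : Code B}
    (f : X -> A -> B) (s : X -> seq A) :
  computable s -> computable (fun p : X * A => f p.1 p.2) ->
  computable (fun x => map (f x) (s x)).
Proof.
move=> Hs Hf; apply: (@computable_ext _ _ _ _
  (fun x => foldr (fun a u => f x a :: u) [::] (s x))).
  by move=> x; elim: (s x) => //= a u ->.
computability.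
apply: (computable_comp (g := fun p => f p.1 p.2) (f := fun p => (p.1, p.2.2))) => //.
by computability.
Qed.

Lemma computable_cat X A {cX : Code X} {cA : Code A} (s t : X -> seq A) :
  computable s -> computable t -> computable (fun x => s x ++ t x).
Proof.
move=> Hs Ht; apply: (@computable_ext _ _ _ _ (fun x => foldr cons (t x) (s x))).
  by move=> x; elim: (s x) => //= a u ->.
by computability.
Qed.

Lemma computable_mul X {cX : Code X} (m n : X -> nat) :
  computable m -> computable n -> computable (fun x => m x * n x).
Proof.
move=> Hm Hn; apply: (@computable_ext _ _ _ _ (fun x => iter (m x) (addn (n x)) 0)).
  by move=> x; rewrite iter_addn_0 mulnC.
computability.
Qed.

Lemma computable_exp X {cX : Code X} (m n : X -> nat) :
  computable m -> computable n -> computable (fun x => m x ^ n x).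
Proof.
move=> Hm Hn; apply: (@computable_ext _ _ _ _ (fun x => iter (n x) (muln (m x)) 1)).
  by move=> x; elim: (n x) => //= k ->; rewrite expnS.
computability.
apply: computable_mul; computability.
Qed.

(** Reads a numeral off an arbitrary tree. *)
Definition spine (t : tree) : nat := para (fun _ _ _ n => n.+1) 0 t.

Lemma spine_nat n : spine (code_nat n) = n.
Proof. by elim: n => //= n; rewrite /spine /= => ->. Qed.

Lemma computable_spine X {cX : Code X} (t : X -> tree) :
  computable t -> computable (fun x => spine (t x)).
Proof.
move=> Ht; apply: (@computable_para _ _ _ _ (fun _ _ _ _ n => n.+1)); computability.
Qed.

Definition nth0 A (s : seq (seq A)) : seq A := case_seq s [::] (fun a _ => a).
Definition nth1 A (s : seq (seq A)) : seq A := nth0 (case_seq s [::] (fun _ t => t)).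

#[export] Instance code_eufn_term_inst : Code eufn_term := code_term.
#[export] Instance code_lin_inst : Code lin := code_lin.
#[export] Instance code_formula_inst : Code (formula eufn_term) := code_formula.
#[export] Instance code_st_formula_inst : Code st_formula := code_st_formula.

Lemma computable_loop_var X {cX : Code X} (j : X -> nat) :
  computable j -> computable (fun x => loop_var (j x)).
Proof.
move=> Hj; apply: (@computable_code _ _ _ _ _ _ (fun x => Cons (code_int 0)
  (Cons (Cons (code_int 1) (code (j x))) Nil))) => //.
by computability; apply: computable_tree.
Qed.

Lemma computable_NVar X {cX : Code X} (n : X -> nat) :
  computable n -> computable (fun x => NVar (n x)).
Proof.
move=> Hn; apply: (@computable_code _ _ _ _ _ _ (fun x => Cons (code_nat 0)
  (Cons (code (n x)) Nil))) => //.
by computability; apply: computable_tree.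
Qed.

Lemma computable_NPow X {cX : Code X} (s : X -> seq nat) (l : X -> lin) (t : X -> eufn_term) :
  computable s -> computable l -> computable t ->
  computable (fun x => NPow (s x) (l x) (t x)).
Proof.
move=> Hs Hl Ht; apply: (@computable_code _ _ _ _ _ _ (fun x => Cons (code_nat 1)
  (Cons (code (s x)) (Cons (code (l x)) (Cons (code (t x)) Nil))))) => //.
by computability; apply: computable_tree.
Qed.

Lemma computable_FEq X {cX : Code X} (t1 t2 : X -> eufn_term) :
  computable t1 -> computable t2 -> computable (fun x => FEq (t1 x) (t2 x)).
Proof.
move=> H1 H2; apply: (@computable_code _ _ _ _ _ _ (fun x => Cons (code_nat 0)
  (Cons (code (t1 x)) (Cons (code (t2 x)) Nil)))) => //.
by computability; apply: computable_tree.
Qed.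

Lemma computable_FNot X {cX : Code X} (phi : X -> formula eufn_term) :
  computable phi -> computable (fun x => FNot (phi x)).
Proof.
move=> H1; apply: (@computable_code _ _ _ _ _ _ (fun x => Cons (code_nat 1)
  (Cons (code (phi x)) Nil))) => //.
by computability; apply: computable_tree.
Qed.

Lemma computable_FAnd X {cX : Code X} (phi psi : X -> formula eufn_term) :
  computable phi -> computable psi -> computable (fun x => FAnd (phi x) (psi x)).
Proof.
move=> H1 H2; apply: (@computable_code _ _ _ _ _ _ (fun x => Cons (code_nat 2)
  (Cons (code (phi x)) (Cons (code (psi x)) Nil)))) => //.
by computability; apply: computable_tree.
Qed.

Lemma computable_FOr X {cX : Code X} (phi psi : X -> formula eufn_term) :
  computable phi -> computable psi -> computable (fun x => FOr (phi x) (psi x)).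
Proof.
move=> H1 H2; apply: (@computable_code _ _ _ _ _ _ (fun x => Cons (code_nat 3)
  (Cons (code (phi x)) (Cons (code (psi x)) Nil)))) => //.
by computability; apply: computable_tree.
Qed.

Lemma computable_StFormula X {cX : Code X} (phi : X -> formula eufn_term) (s t : X -> nat) :
  computable phi -> computable s -> computable t ->
  computable (fun x => StFormula (phi x) (s x) (t x)).
Proof.
move=> H1 H2 H3; apply: (@computable_code _ _ _ _ _ _ (fun x =>
  Cons (code (phi x)) (Cons (code (s x)) (Cons (code (t x)) Nil)))) => //.
by computability; apply: computable_tree.
Qed.

Ltac computable_user ::=
  lazymatch goal with
  | |- computable (fun x => hd (@?t x)) => apply: (@computable_hd _ _ t)
  | |- computable (fun x => tl (@?t x)) => apply: (@computable_tl _ _ t)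
  | |- computable (fun x => (@?n x).-1) => apply: (@computable_pred _ _ n)
  | |- computable (fun x => @?m x == @?n x) => apply: (@computable_eqn _ _ m n)
  | |- computable (fun x => @?m x + @?n x) => apply: (@computable_add _ _ m n)
  | |- computable (fun x => @?m x - @?n x) => apply: (@computable_sub _ _ m n)
  | |- computable (fun x => @?m x * @?n x) => apply: (@computable_mul _ _ m n)
  | |- computable (fun x => @?m x ^ @?n x) => apply: (@computable_exp _ _ m n)
  | |- computable (fun x => spine (@?t x)) => apply: (@computable_spine _ _ t)
  | |- computable (fun x => rev (@?s x)) => apply: (@computable_rev _ _ _ _ s)
  | |- computable (fun x => @?s x ++ @?t x) => apply: (@computable_cat _ _ _ _ s t)
  | |- computable (fun x => map (@?f x) (@?s x)) => apply: (@computable_map _ _ _ _ _ _ f s)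
  | |- computable (fun x => nth0 (@?s x)) => rewrite /nth0
  | |- computable (fun x => nth1 (@?s x)) => rewrite /nth1
  | |- computable (fun x => foldr (@?g x) (@?b x) (@?l x)) =>
      apply: (@computable_foldr _ _ _ _ _ _ g b l)
  | |- computable (fun x => loop_var (@?j x)) => apply: (@computable_loop_var _ _ j)
  | |- computable (fun x => NVar (@?n x)) => apply: (@computable_NVar _ _ n)
  | |- computable (fun x => NPow (@?s x) (@?l x) (@?t x)) =>
      apply: (@computable_NPow _ _ s l t)
  | |- computable (fun x => FEq (@?s x) (@?t x)) => apply: (@computable_FEq _ _ s t)
  | |- computable (fun x => FNot (@?s x)) => apply: (@computable_FNot _ _ s)
  | |- computable (fun x => FAnd (@?s x) (@?t x)) => apply: (@computable_FAnd _ _ s t)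
  | |- computable (fun x => FOr (@?s x) (@?t x)) => apply: (@computable_FOr _ _ s t)
  | |- computable (fun x => StFormula (@?p x) (@?s x) (@?t x)) =>
      apply: (@computable_StFormula _ _ p s t)
  end.

Lemma computable_nf X {cX : Code X} (v : X -> seq nlet) :
  computable v -> computable (fun x => nf (v x)).
Proof.
move=> Hv; pose step (a : nlet) (o : option (seq nat * seq nat)) :=
  case_option o None (fun n => case_bool a.1
    (case_seq n.1 (Some ([::], a.2 :: n.2))
      (fun j C => case_bool (j == a.2) (Some (C, n.2)) None))
    (Some (a.2 :: n.1, n.2))).
apply: (@computable_ext _ _ _ _ (fun x => foldr step (Some ([::], [::])) (v x))).
  by move=> x; elim: (v x) => //= a u ->; case: (nf u) => [[[|j C] B]|].
by rewrite /step; computability.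
Qed.

Lemma computable_strip X {cX : Code X} (p s : X -> seq nat) :
  computable p -> computable s -> computable (fun x => strip (p x) (s x)).
Proof.
move=> Hp Hs; pose step (o : option (seq nat)) (c : nat) :=
  case_option o None (fun s => case_seq s None
    (fun d s' => case_bool (d == c) (Some s') None)).
apply: (@computable_ext _ _ _ _ (fun x => foldl step (Some (s x)) (p x))).
  have N u : foldl step None u = None by elim: u.
  move=> x; elim: (p x) (s x) => //= c u IH [|d w] //=.
  by rewrite /case_bool; case: eqP.
by rewrite /step; computability.
Qed.

Lemma computable_letter_eq X {cX : Code X} (a : X -> nlet) (t1 t2 : X -> eufn_term) :
  computable a -> computable t1 -> computable t2 ->
  computable (fun x => letter_eq (a x) (t1 x) (t2 x)).
Proof.
move=> Ha H1 H2; apply: (@computable_ext _ _ _ _ (fun x => case_bool (a x).1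
  (FEq (t1 x) (NPow [:: (a x).2.+1] one (t2 x))) (FEq (NPow [:: (a x).2.+1] one (t1 x)) (t2 x)))).
  by [].
by computability.
Qed.

Lemma computable_once_eq X {cX : Code X} (v : X -> seq nlet) (t1 t2 : X -> eufn_term) :
  computable v -> computable t1 -> computable t2 ->
  computable (fun x => once_eq (v x) (t1 x) (t2 x)).
Proof.
move=> Hv H1 H2; apply: (@computable_ext _ _ _ _ (fun x => case_option (nf (v x))
  (FEq (t1 x) (t1 x)) (fun n => FEq (NPow (map succn (rev n.1)) one (t1 x))
    (NPow (map succn n.2) one (t2 x))))).
  by move=> x; rewrite /once_eq; case: (nf _) => [[]|].
by computability; apply: computable_nf.
Qed.

Lemma computable_many_eq X {cX : Code X} (v : X -> seq nlet) (j : X -> nat)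
    (t1 t2 : X -> eufn_term) :
  computable v -> computable j -> computable t1 -> computable t2 ->
  computable (fun x => many_eq (v x) (j x) (t1 x) (t2 x)).
Proof.
move=> Hv Hj H1 H2; apply: (@computable_ext _ _ _ _ (fun x => case_option (nf (v x))
  (FEq (t1 x) (t1 x)) (fun n =>
   case_option (strip n.1 (rev n.2))
     (case_option (strip (rev n.2) n.1) (FEq (t1 x) (t1 x)) (fun r =>
       FEq (NPow (map succn (rev r)) (loop_var (j x)) (NPow (map succn n.2) one (t1 x)))
         (NPow (map succn n.2) one (t2 x))))
     (fun r => FEq (NPow (map succn (rev n.1)) one (t1 x))
        (NPow (map succn (rev r)) (loop_var (j x)) (NPow (map succn (rev n.1)) one (t2 x))))))).
  move=> x; rewrite /many_eq; case: (nf _) => [[C B]|] //=.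
computability; first exact: computable_nf.
- by apply: computable_strip; computability.
- by apply: computable_strip; computability.
Qed.

Lemma computable_item_eq X {cX : Code X} (it : X -> item nlet) (j i : X -> nat) :
  computable it -> computable j -> computable i ->
  computable (fun x => item_eq (it x) (j x) (i x)).
Proof.
move=> Hit Hj Hi; apply: (@computable_ext _ _ _ _ (fun x => case_sum (it x)
  (fun a => letter_eq a (NVar (i x).+3) (NVar (i x).+4))
  (fun v => FAnd (if_count (j x) 0 (FEq (NVar (i x).+3) (NVar (i x).+4)))
    (FAnd (if_count (j x) 1 (once_eq v (NVar (i x).+3) (NVar (i x).+4)))
      (if_count (j x) 2 (many_eq v (j x) (NVar (i x).+3) (NVar (i x).+4))))))).
  by move=> x; case: (it x).
rewrite /if_count; computability.
- by apply: computable_letter_eq; computability.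
- by apply: computable_once_eq; computability.
- by apply: computable_many_eq; computability.
Qed.

Lemma computable_encode_items X {cX : Code X} (l : X -> seq (item nlet)) :
  computable l -> computable (fun x => encode_items (l x)).
Proof.
move=> Hl; rewrite /encode_items.
have Hs : computable (fun x => foldl encode_step
    (0, (0, FAnd counters (FEq (NVar 3) (NVar 3)))) (l x)).
  apply: (@computable_ext _ _ _ _ (fun x => foldl (fun s it => (s.1.+1,
    (case_sum it (fun _ => s.2.1) (fun _ => s.2.1.+1), FAnd s.2.2 (item_eq it s.2.1 s.1))))
    (0, (0, FAnd counters (FEq (NVar 3) (NVar 3)))) (l x))).
    by move=> x.
  by computability; apply: computable_item_eq; computability.
by computability; apply: computable_comp Hs; computability.
Qed.

Definition label_nlet (side : bool) ka kb (c : label ka kb) : option nlet :=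
  match c with
  | inl a => if side then Some (nlet_of a) else None
  | inr b => if side then None else Some (nlet_of b)
  end.

(* The code of a letter, and below of a label and of a regular expression, is
   decoded without knowing the alphabets. *)
Definition decode_nlet (t : tree) : nlet := (spine (hd t) == 0, spine (hd (tl t))).

Definition decode_label (t : tree) : bool * nlet :=
  (spine (hd t) == 0, decode_nlet (hd (tl t))).

Lemma decode_label_code ka kb (c : label ka kb) :
  decode_label (code_label c) =
  match c with inl a => (true, nlet_of a) | inr b => (false, nlet_of b) end.
Proof. by case: c => [[] i|[] i]; rewrite /decode_label /decode_nlet /= spine_nat. Qed.

(* The first component is the item sequence of a regular expression, the second
   that of each element of a list of regular expressions. *)
Definition decode_step (side : bool) (l r : tree)
    (vl vr : seq (item nlet) * seq (seq (item nlet))) :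
    seq (item nlet) * seq (seq (item nlet)) :=
  (case_bool (spine l == 2)
    (case_bool (case_bool (decode_label (hd r)).1 side (case_bool side false true))
       [:: inl (decode_label (hd r)).2] [::])
    (case_bool (spine l == 4) (nth0 vr.2 ++ nth1 vr.2)
      (case_bool (spine l == 5) [:: inr (plain_letters (nth0 vr.2))] [::])),
   vl.1 :: vr.2).

Definition decode_items (side : bool) (t : tree) : seq (item nlet) :=
  (para (decode_step side) ([::], [::]) t).1.

Lemma decode_items_code side ka kb (r : regexp (label ka kb)) :
  decode_items side (code_regexp r) = pmap (item_pmap (@label_nlet side ka kb)) (items r).
Proof.
have plainE l : plain_letters (pmap (item_pmap (@label_nlet side ka kb)) l) =
    pmap (@label_nlet side ka kb) (plain_letters l).
  by elim: l => [|[a|v] l IH] //=; case: (label_nlet side a) => //= b; rewrite -IH.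
elim: r => //= [c|r1 IH1 r2 IH2|r IH].
- rewrite -[LHS]/(case_bool (case_bool (decode_label (code_label c)).1 side
    (case_bool side false true)) [:: inl (decode_label (code_label c)).2] [::]).
  rewrite decode_label_code.
  by case: c => a /=; rewrite /case_bool; case: (side).
- by rewrite pmap_cat -IH1 -IH2.
- by rewrite -plainE -IH.
Qed.

Lemma computable_decode_nlet X {cX : Code X} (t : X -> tree) :
  computable t -> computable (fun x => decode_nlet (t x)).
Proof. by move=> Ht; rewrite /decode_nlet; computability. Qed.

Lemma computable_decode_label X {cX : Code X} (t : X -> tree) :
  computable t -> computable (fun x => decode_label (t x)).
Proof.
by move=> Ht; rewrite /decode_label; computability; apply: computable_decode_nlet; computability.
Qed.

Lemma computable_decode_items X {cX : Code X} (side : bool) (t : X -> tree) :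
  computable t -> computable (fun x => decode_items side (t x)).
Proof.
move=> Ht; rewrite /decode_items; computability.
apply: (@computable_para _ _ _ _ (fun=> decode_step side)) => //; first exact: computable_const.
rewrite /decode_step; computability; try by apply: computable_decode_label; computability.
rewrite /plain_letters; apply: (@computable_ext _ _ _ _ (fun p => foldr
  (fun it u => case_sum it (fun a => a :: u) (fun _ => u)) [::] (nth0 p.2.2.2.2))).
  by move=> p; elim: (nth0 _) => // -[a|v] l /= ->.
by computability.
Qed.

Definition encode_regexp (t : tree) : st_formula * st_formula :=
  (encode_items (decode_items true t), encode_items (decode_items false t)).

Lemma expresses_ext q Psi (Q Q' : (nat -> nat) -> Prop) :
  (forall sigma, Q sigma <-> Q' sigma) -> expresses q Psi Q -> expresses q Psi Q'.
Proof.
move=> E [H1 H2 H3 H4]; split=> // sigma; have [H5 H6] := H4 sigma.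
by split=> //; rewrite -E.
Qed.

Lemma encode_regexp_correct ka kb (r : regexp (label ka kb)) :
  well_formed r -> is_encoding r (encode_regexp (code_regexp r)).
Proof.
move=> W.
have [Eq _] := well_formed_unroll (fun=> 0) 0 W.
rewrite /is_encoding /= Eq !decode_items_code.
have H side k (f : label ka kb -> option (letter k)) :
    (forall c, label_nlet side c = omap (@nlet_of k) (f c)) ->
    expresses (nloops (items r))
      (encode_items (pmap (item_pmap (@label_nlet side ka kb)) (items r)))
      (fun sigma => dyck (pmap f (unroll sigma r))).
  move=> Hf; have := encode_items_expresses (pmap (item_pmap (@label_nlet side ka kb)) (items r)).
  rewrite nloops_pmap; apply: expresses_ext => sigma.
  have [_ Eu] := well_formed_unroll sigma 0 W.
  rewrite dyckP -pmap_words -Eu -/(unroll sigma r).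
  suff -> : pmap (@label_nlet side ka kb) (unroll sigma r) = map (@nlet_of k) (pmap f (unroll sigma r)) by [].
  by elim: (unroll sigma r) => //= c u ->; rewrite Hf; case: (f c).
by split; apply: H => -[].
Qed.

Lemma encode_program : exists encode : cmd, forall ka kb (P : seq (regexp (label ka kb))),
  (forall r, List.In r P -> well_formed r) ->
  exists es : seq (st_formula * st_formula),
    exec encode (code_exprs P) (code_seq code_encoding es) /\
    List.Forall2 (fun r e => is_encoding r e) P es.
Proof.
have [c Hc] : computable (fun t => map encode_regexp (elems t)).
  computability; rewrite /encode_regexp; computability;
    by apply: computable_encode_items; apply: computable_decode_items; computability.
exists c => ka kb P HP; exists (map encode_regexp (map (@code_regexp ka kb) P)); split.
  have := Hc (code_exprs P).
  by have -> : elems (code_exprs P) = map (@code_regexp ka kb) P by elim: (P) => //= r u ->.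
elim: P HP => [|r P IH] HP /=; first exact: List.Forall2_nil.
apply: List.Forall2_cons; first by apply: encode_regexp_correct; apply: HP; left.
by apply: IH => r' Hr'; apply: HP; right.
Qed.

(** * Derivations of a commutative grammar *)

Section Grammar.
Variables (V R : finType) (lhs : R -> V) (rhs : R -> seq V).
Implicit Types (x : R -> nat) (s : seq V) (A B : V).

(** Leftmost derivations down to the empty sentential form. Right-hand sides list nonterminals only;
    the terminals emitted are recovered from the rules. *)
Inductive derivation : seq V -> seq R -> Prop :=
  | derivation_nil : derivation [::] [::]
  | derivation_cons r s rs :
      derivation (rhs r ++ s) rs -> derivation (lhs r :: s) (r :: rs).

Inductive accessible x s : V -> Prop :=
  | accessible_start A : A \in s -> accessible x s A
  | accessible_rule r A :
      accessible x s (lhs r) -> 0 < x r -> A \in rhs r -> accessible x s A.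

Definition balanced s x : Prop := forall A,
  count_mem A s + \sum_r x r * count_mem A (rhs r) = \sum_r x r * (lhs r == A).

(** Balance alone would admit cycles of rules detached from [s], which no derivation from [s] can
    use. *)
Definition flow s x : Prop :=
  balanced s x /\ forall r, 0 < x r -> accessible x s (lhs r).

Lemma accessible_sub x y s t A :
  (forall r, 0 < x r -> 0 < y r) -> {subset s <= t} ->
  accessible x s A -> accessible y t A.
Proof.
move=> xy st; elim=> {A} [A /st|r A _ IH /xy H Ar]; first exact: accessible_start.
exact: accessible_rule IH H Ar.
Qed.

Definition use_rule (r : R) x : R -> nat := fun r' => x r' + (r' == r).

Lemma sum_use_rule r x (f : R -> nat) :
  \sum_r' use_rule r x r' * f r' = f r + \sum_r' x r' * f r'.
Proof.
rewrite /use_rule; under eq_bigr => r' _ do rewrite mulnDl.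
rewrite big_split /= addnC; congr (_ + _).
rewrite (bigD1 r) //= eqxx mul1n big1 ?addn0 // => r' /negPf ->.
by rewrite mul0n.
Qed.

Lemma flow_use_rule r x : flow (rhs r) x -> flow [:: lhs r] (use_rule r x).
Proof.
have lr : accessible (use_rule r x) [:: lhs r] (lhs r).
  by apply: accessible_start; rewrite inE.
move=> [B C]; split=> [A|r' Hr'].
  rewrite (sum_use_rule _ _ (fun r' => count_mem A (rhs r'))).
  rewrite (sum_use_rule _ _ (fun r' => (lhs r' == A) : nat)) /= addn0.
  by rewrite B.
have [->|ne] := eqVneq r' r; first exact: lr.
have {}Hr' : 0 < x r' by move: Hr'; rewrite /use_rule (negPf ne) addn0.
elim: (C _ Hr') => {r' ne Hr'} [A Ar|r' A _ IH Hr' Ar'].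
  by apply: accessible_rule lr _ Ar; rewrite /use_rule eqxx addn1.
by apply: accessible_rule IH _ Ar'; rewrite /use_rule ltn_addr.
Qed.

Lemma flow_cat s t x y :
  flow s x -> flow t y -> flow (s ++ t) (fun r => x r + y r).
Proof.
move=> [Bs Cs] [Bt Ct]; split=> [A|r].
  rewrite count_cat; under eq_bigr => r _ do rewrite mulnDl.
  under [RHS]eq_bigr => r _ do rewrite mulnDl.
  by rewrite !big_split /= addnACA Bs Bt.
case: (posnP (x r)) => [->|/Cs As _].
  rewrite add0n => /Ct; apply: accessible_sub => [r'|A]; last by rewrite mem_cat orbC => ->.
  by rewrite addn_gt0 orbC => ->.
move: As; apply: accessible_sub => [r'|A]; last by rewrite mem_cat => ->.
by rewrite addn_gt0 => ->.
Qed.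

(* If [A] stays accessible after one of its rules is used, that rule is a good
   choice.  Otherwise no rule of [x] produces [A], so that by balance a single
   use of a rule of [A] is left. *)
Lemma flow_step A s x : flow (A :: s) x ->
  exists r y, [/\ lhs r = A, x =1 use_rule r y & flow (rhs r ++ s) y].
Proof.
move=> [B C].
(* With the rules of [A] switched off, accessibility survives the removal of a use of any of
   them. *)
pose xA r := if lhs r == A then 0 else x r.
have BA := B A; rewrite /= eqxx in BA.
have [r0 r0A x0] : exists2 r, lhs r = A & 0 < x r.
  apply: NNPP => H; move: BA; rewrite [RHS]big1 // => r _.
  case: eqP => [E|_]; last by rewrite muln0.
  by case: (posnP (x r)) => [-> //|Hx]; case: H; exists r.
suff [r [rA xr acc]] : exists r, [/\ lhs r = A, 0 < x r &
    forall r', 0 < x r' - (r' == r) ->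
      accessible (fun r' => x r' - (r' == r)) (rhs r ++ s) (lhs r')].
  exists r, (fun r' => x r' - (r' == r)).
  have E : x =1 use_rule r (fun r' => x r' - (r' == r)).
    by move=> r'; rewrite /use_rule; case: eqP => [->|]; lia.
  split=> //; split=> // D; have := B D.
  under eq_bigr => r' _ do rewrite E.
  under [X in _ = X -> _]eq_bigr => r' _ do rewrite E.
  rewrite (sum_use_rule _ _ (fun r' => count_mem D (rhs r'))).
  rewrite (sum_use_rule _ _ (fun r' => (lhs r' == D) : nat)) /= count_cat rA.
  lia.
have [[r [rA xr Acc]]|none] := classic (exists r,
    [/\ lhs r = A, 0 < x r & accessible xA (rhs r ++ s) A]).
  exists r; split=> // r' Hr'; have {}Hr' : 0 < x r' by lia.
  elim: (C _ Hr') => {r' Hr'} [D|r' D _ IH Hr' Dr'].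
    rewrite inE => /predU1P[->|Ds]; last by apply: accessible_start; rewrite mem_cat Ds orbT.
    apply: accessible_sub Acc => // r'; rewrite /xA; case: eqP => // /eqP ne.
    by rewrite (_ : (r' == r) = false) ?subn0 //; apply: contraNF ne => /eqP ->; rewrite rA.
  have [Er|ne] := eqVneq r' r.
    by apply: accessible_start; rewrite mem_cat -Er Dr'.
  by apply: accessible_rule IH _ Dr'; rewrite (negPf ne) subn0.
(* A chain of rules leading to [D] is cut at its last visit to [A]. *)
have acc D : accessible x (A :: s) D ->
    D = A \/ exists r, [/\ lhs r = A, 0 < x r & accessible xA (rhs r ++ s) D].
  elim=> {D} [D|r D _ IH xr Dr].
    rewrite inE => /predU1P[->|Ds]; [by left | right; exists r0; split=> //].
    by apply: accessible_start; rewrite mem_cat Ds orbT.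
  right; have [rA|ne] := eqVneq (lhs r) A.
    by exists r; split=> //; apply: accessible_start; rewrite mem_cat Dr.
  case: IH => [/eqP|[r' [r'A xr' Acc]]]; first by rewrite (negPf ne).
  exists r'; split=> //; apply: accessible_rule Acc _ Dr.
  by rewrite /xA (negPf ne).
have As : A \notin s.
  apply/negP => As; apply: none; exists r0; split=> //.
  by apply: accessible_start; rewrite mem_cat As orbT.
have noA r : 0 < x r -> A \notin rhs r.
  move=> xr; apply/negP => Ar; apply: none.
  have [rA|ne] := eqVneq (lhs r) A.
    by exists r; split=> //; apply: accessible_start; rewrite mem_cat Ar.
  case: (acc _ (C _ xr)) => [/eqP|[r' [r'A xr' Acc]]]; first by rewrite (negPf ne).
  exists r'; split=> //; apply: accessible_rule Acc _ Ar.
  by rewrite /xA (negPf ne).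
have one : \sum_r x r * (lhs r == A) = 1.
  rewrite -BA (count_memPn As) big1 // => r _.
  by case: (posnP (x r)) => [-> //|/noA H]; rewrite (count_memPn H) muln0.
have uniq_r r : lhs r = A -> 0 < x r -> r = r0.
  move=> rA xr; apply/eqP/negPn/negP => ne; move: one.
  by rewrite (bigD1 r0) //= (bigD1 r) //= r0A rA eqxx; lia.
have x01 : x r0 = 1.
  by move: one; rewrite (bigD1 r0) //= r0A eqxx; lia.
exists r0; split=> // r Hr.
have ne : r != r0 by apply: contraTneq Hr => ->; rewrite eqxx x01.
have xr : 0 < x r by lia.
have lA : lhs r <> A by move=> rA; move/eqP: ne; apply; apply: uniq_r.
case: (acc _ (C _ xr)) => [//|[r1 [r1A xr1]]].
rewrite (uniq_r r1) //; apply: accessible_sub => // r'; rewrite /xA.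
case: eqP => // ne' xr'; case: eqP => [E|_]; last by rewrite subn0.
by rewrite E r0A in ne'.
Qed.

Theorem flow_derivation s x : flow s x ->
  exists2 rs, derivation s rs & forall r, count_mem r rs = x r.
Proof.
have [n] := ubnP (\sum_r x r); elim: n s x => // n IH [|A s] x Hn F.
  exists [::]; first exact: derivation_nil.
  move=> r; case: F => B C; case: (posnP (x r)) => [-> //|Hr].
  suff : forall D, ~ accessible x [::] D by move/(_ _ (C _ Hr)).
  by move=> D; elim.
have [r [y [rA E Fy]]] := flow_step F.
have [|rs Drs Crs] := IH _ _ _ Fy.
  move: Hn; under eq_bigr => r' _ do rewrite E -[use_rule _ _ _]muln1.
  by rewrite (sum_use_rule _ _ (fun=> 1)); under eq_bigr => r' _ do rewrite muln1.
exists (r :: rs); first by rewrite -rA; apply: derivation_cons.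
by move=> r' /=; rewrite Crs E /use_rule eq_sym addnC.
Qed.

End Grammar.

(** * Small solutions of linear systems *)

Section OneEquation.
Variables (T : eqType) (a : T -> int) (M : nat).
Hypothesis aM : forall t, `|a t|%N <= M.
Local Notation wt s := (\sum_(t <- s) a t)%R.

(* The order alternates signs so as to bring the partial sum back towards 0. *)
Lemma balanced_order (s : seq T) (S0 : int) :
  `|S0|%N <= M -> `|(S0 + wt s)%R|%N <= M ->
  exists2 s', perm_eq s' s & forall i, `|(S0 + wt (take i s'))%R|%N <= M.
Proof.
have [n] := ubnP (size s); elim: n s S0 => // n IH [|t0 s0] S0 Hn H0 H1.
  by exists [::] => // i; rewrite big_nil addr0.
pose good := fun t => if (0 <= S0)%R then (a t <= 0)%R else (0 <= a t)%R.
set s := t0 :: s0 in Hn H1 *.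
have [/hasP[t ts gt]|/hasPn bad] := boolP (has good s).
  have P := perm_to_rem ts.
  have Hw : wt s = (a t + wt (rem t s))%R by rewrite (perm_big _ P) big_cons.
  have [||| s' P' B] := IH (rem t s) (S0 + a t)%R.
  - by rewrite size_rem //; move: Hn; case: (s).
  - by have := aM t; move: gt; rewrite /good; case: ifP; lia.
  - by move: H1; rewrite Hw addrA.
  exists (t :: s'); first by rewrite (permPr P) perm_cons.
  by case=> [|i] /=; rewrite ?big_nil ?addr0 // big_cons addrA.
(* All remaining coefficients lead away from 0, so the partial sums are monotone between [S0] and
   the final sum, both of which are bounded. *)
exists s => // i.
have E : wt s = (wt (take i s) + wt (drop i s))%R.
  by rewrite -big_cat cat_take_drop.
have sgn u : {subset u <= s} -> if (0 <= S0)%R then (0 <= wt u)%R else (wt u <= 0)%R.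
  move=> us; rewrite big_seq; case: ifP => HS.
    apply: sumr_ge0 => t /us/bad; rewrite /good HS; lia.
  apply: sumr_le0 => t /us/bad; rewrite /good HS; lia.
have Ht : {subset take i s <= s} by move=> t /mem_take.
have Hd : {subset drop i s <= s} by move=> t /mem_drop.
move: (sgn _ Ht) (sgn _ Hd) H0 H1; rewrite E.
by case: ifP; lia.
Qed.

(** Pigeonhole: in a balanced order the partial sums take at most [2 * M + 1] values, so two of the
    first [2 * M + 2] coincide and the segment between them has sum 0. *)
Lemma balanced_subword (s : seq T) :
  `|wt s|%N <= M -> (2 * M).+1 <= size s ->
  exists u v, [/\ perm_eq (u ++ v) s, wt v = 0%R & 0 < size v <= (2 * M).+1].
Proof.
move=> Hs Hsize.
have [|//|s' P B] := balanced_order (S0 := 0%R) (s := s); rewrite ?add0r //.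
(* Shifting by [M] turns the partial sums into naturals below [2 * M + 1]. *)
pose f (i : nat) := absz (wt (take i s') + M%:Z)%R.
have : ~~ uniq [seq f i | i <- iota 0 (2 * M).+2].
  apply/negP => U.
  have sub : {subset [seq f i | i <- iota 0 (2 * M).+2] <= iota 0 (2 * M).+1}.
    move=> _ /mapP[i _ ->]; rewrite mem_iota /f; have := B i; rewrite add0r; lia.
  by have := uniq_leq_size U sub; rewrite size_map !size_iota ltnn.
move/(uniqPn 0)=> [i [j [ij]]]; rewrite size_map size_iota => Hj.
have Hi := ltn_trans ij Hj.
rewrite !(nth_map 0) ?size_iota ?nth_iota //.
rewrite !add0n => Ef.
have E : wt (take i s') = wt (take j s').
  by have := B i; have := B j; move: Ef; rewrite /f !add0r; lia.
have js : j <= size s' by rewrite (perm_size P); lia.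
exists (take i s' ++ drop j s'), (drop i (take j s')); split.
- have Es : s' = take i s' ++ drop i (take j s') ++ drop j s'.
    by rewrite catA -[take i s'](take_takel _ (ltnW ij)) !cat_take_drop.
  by rewrite -(permPr P) [X in perm_eq _ X]Es -catA perm_cat2l perm_catC.
- have : wt (take j s') = (wt (take i s') + wt (drop i (take j s')))%R.
    by rewrite -(take_takel s' (ltnW ij)) -big_cat cat_take_drop.
  by rewrite E -[LHS]addr0 => /addrI <-.
- by rewrite size_drop size_takel //; lia.
Qed.

(** Zero-sum segments are split off until the rest is short. The rest carries the right-hand side,
    the segments are short solutions of the homogeneous equation. *)
Lemma decompose_solution (s : seq T) : `|wt s|%N <= M ->
  exists c l, [/\ perm_eq (c ++ flatten l) s, wt c = wt s,
    (forall v, v \in l -> wt v = 0%R /\ size v <= (2 * M).+1)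
    & size c <= (2 * M).+1].
Proof.
have [n] := ubnP (size s); elim: n s => // n IH s Hn Hs.
have [Hsize|Hsize] := leqP (2 * M).+1 (size s); last first.
  by exists s, [::]; rewrite cats0; split=> //; apply: ltnW.
have [u [v [P v0 /andP[v1 vM]]]] := balanced_subword Hs Hsize.
have Hw : wt s = wt u by rewrite -(perm_big _ P) big_cat /= v0 addr0.
have [||c [l [Pc Ec Hl Hc]]] := IH u.
- have := perm_size P; rewrite size_cat; lia.
- by rewrite -Hw.
exists c, (v :: l); split=> //.
- by rewrite -(permPr P) /= catA perm_catAC perm_cat2r.
- by rewrite Hw.
- by move=> v'; rewrite inE => /predU1P[->|/Hl].
Qed.

End OneEquation.

(** * Systems of several equations *)

Definition equation (T : Type) : Type := ((T -> int) * int)%type.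

Definition solves (T : finType) (x : T -> nat) (e : equation T) : bool :=
  (\sum_t e.1 t * (x t)%:Z == e.2)%R.

Definition eq_bounded (T : finType) (M : nat) (e : equation T) : Prop :=
  (forall t, `|e.1 t|%N <= M) /\ `|e.2|%N <= M.

(* [K] bounds the size of the vectors into which [decompose_solution] splits a
   solution of the first equation; the other equations are then solved for the
   multiplicities of these vectors. *)
Fixpoint ilp_bound (m n M : nat) : nat :=
  if m is m'.+1 then
    let K := (2 * M).+1 in
    K + K.+1 ^ n * K * ilp_bound m' (K.+1 ^ n) (M + n * M * K)
  else 0.

Lemma sum_count (T : finType) (R : nmodType) (f : T -> R) (s : seq T) :
  (\sum_(t <- s) f t = \sum_t f t *+ count_mem t s)%R.
Proof.
elim: s => [|u s IH]; first by rewrite big_nil big1 // => t _; rewrite mulr0n.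
rewrite big_cons IH (bigD1 u) //= [in RHS](bigD1 u) //= eqxx mulrS addrA.
by congr (_ + _)%R; apply: eq_bigr => t /negPf; rewrite eq_sym => ->.
Qed.

Lemma sum_countn (T : finType) (f : T -> nat) (s : seq T) :
  \sum_(t <- s) f t = \sum_t count_mem t s * f t.
Proof.
rewrite sum_count; apply: eq_bigr => t _.
by elim: (count_mem t s) => //= k IH; rewrite mulrS IH.
Qed.

Lemma count_flatten_nseq (T : finType) (x : T -> nat) t :
  count_mem t (flatten [seq nseq (x u) u | u <- enum T]) = x t.
Proof.
rewrite count_flatten -map_comp sumnE big_map big_enum /= (bigD1 t) //= big1.
  by rewrite count_nseq /= eqxx mul1n addn0.
by move=> u /negPf Hu; rewrite count_nseq /= Hu.
Qed.

(** The first equation disappears at the price of more unknowns: one multiplicity for each vector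
    with entries at most K. Their coefficients are at most [#|T| * M * K], and the rest [c] moves a
    right-hand side by no more than that. *)
Lemma small_solution (T : finType) (M : nat) (eqs : seq (equation T)) (x : T -> nat) :
  (forall i, i < size eqs -> eq_bounded M (nth ((fun=> 0%R), 0%R) eqs i)) ->
  all (solves x) eqs ->
  exists2 y, all (solves y) eqs & forall t, y t <= ilp_bound (size eqs) #|T| M.
Proof.
move Em: (size eqs) => m.
elim: m T M eqs x Em => [|m IH] T M [|[a b] eqs] x //= Em HM; first by exists (fun=> 0).
case: Em => Em; case/andP=> /eqP /= Hab Heqs.
have [aM bM] : (forall t, `|a t|%N <= M) /\ `|b|%N <= M := HM 0 isT.
set K := (2 * M).+1.
pose s := flatten [seq nseq (x u) u | u <- enum T].
have Es t : count_mem t s = x t by exact: count_flatten_nseq.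
have sumE (f : T -> int) u : (\sum_(t <- u) f t = \sum_t f t * (count_mem t u)%:Z)%R.
  by rewrite sum_count; apply: eq_bigr => t _; rewrite -mulr_natr natz.
have wts : (\sum_(t <- s) a t)%R = b.
  by rewrite sumE -Hab; apply: eq_bigr => t _; rewrite Es.
have [|c [l [P Ec Hl Hc]]] := decompose_solution aM (s := s); first by rewrite wts.
rewrite wts in Ec.
pose U : finType := {ffun T -> 'I_K.+1}.
(* The truncation by [inord] never occurs for the sequences considered, whose length is at most
   K. *)
pose vec (v : seq T) : U := [ffun t => inord (count_mem t v)].
have vecE v t : size v <= K -> vec v t = count_mem t v :> nat.
  by move=> Hv; rewrite ffunE inordK // ltnS (leq_trans (count_size _ _)).
(* Other vectors get coefficient 0, so that their multiplicities, on which the system then puts no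
   constraint, can be discarded. *)
pose valid (p : U) := (\sum_t a t * (p t : nat)%:Z == 0)%R.
pose dot (f : T -> int) (p : U) := (if valid p then \sum_t f t * (p t : nat)%:Z else 0)%R.
pose eqs' : seq (equation U) :=
  [seq (dot e.1, e.2 - \sum_t e.1 t * (count_mem t c)%:Z)%R | e <- eqs].
pose x' (p : U) := count_mem p (map vec l).
have lv v : v \in l -> valid (vec v).
  case/Hl => Hv Hs; apply/eqP; rewrite -[RHS]Hv [RHS]sumE.
  by apply: eq_bigr => t _; rewrite vecE.
have dotle (f : T -> int) p : (forall t, `|f t|%N <= M) -> `|dot f p|%N <= #|T| * M * K.
  move=> fM; rewrite /dot; case: ifP => // _.
  rewrite -lez_nat abszE; apply: (le_trans (ler_norm_sum _ _ _)).
  rewrite -mulnA -sum_nat_const -natz natr_sum; apply: ler_sum => t _.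
  rewrite natz normrM PoszM; apply: ler_pM => //; [have := fM t | have := ltn_ord (p t)]; lia.
have sumdot (f : T -> int) (z : U -> nat) :
   (\sum_p dot f p * (z p)%:Z = \sum_t f t * (\sum_(p | valid p) z p * p t)%N%:Z)%R.
  under [RHS]eq_bigr => t _ do rewrite -natz natr_sum mulr_sumr.
  rewrite exchange_big /= [RHS]big_mkcond; apply: eq_bigr => p _; rewrite /dot.
  case: ifP => _; last by rewrite mul0r.
  by rewrite mulr_suml; apply: eq_bigr => t _; rewrite natrM !natz mulrAC -mulrA.
have [|||y' Hy' By'] := IH U (M + #|T| * M * K) eqs' x'.
- by rewrite size_map.
- move=> i; move=> Hi; rewrite (nth_map ((fun=> 0%R), 0%R)) ?Em //.
  have /= [eM eb] := HM i.+1 Hi; split=> /= [p|].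
    by apply: (leq_trans (dotle _ _ eM)); rewrite leq_addl.
  set e := nth _ _ _ in eM eb *.
  have : `|(\sum_t e.1 t * (count_mem t c)%:Z)%R|%N <= #|T| * M * K.
    rewrite -lez_nat abszE; apply: (le_trans (ler_norm_sum _ _ _)).
    rewrite -mulnA -sum_nat_const -natz natr_sum; apply: ler_sum => t _.
    rewrite natz normrM PoszM; apply: ler_pM => //;
      [have := eM t | have := count_size (pred1 t) c]; lia.
  move: (#|T| * M * K) (\sum_t _)%R eb => B X; lia.
- rewrite all_map; apply: sub_all Heqs => e /eqP He; apply/eqP => /=.
  rewrite sumdot -He -sumrB; apply: eq_bigr => t _; rewrite -mulrBr; congr (_ * _)%R.
  suff -> : x t = count_mem t c + \sum_(p | valid p) x' p * p t by rewrite PoszD addrAC subrr add0r.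
  rewrite -Es -(permP P) count_cat; congr (_ + _).
  rewrite count_flatten sumnE big_map.
  have -> : \sum_(v <- l) count_mem t v = \sum_(p <- map vec l) p t.
    by rewrite big_map; apply: eq_big_seq => v /Hl[_ Hs]; rewrite vecE.
  rewrite (sum_countn (fun p : U => p t : nat)) [RHS]big_mkcond; apply: eq_bigr => p _.
  rewrite -[RHS]/(if valid p then x' p * p t else 0) /x'.
  case: ifP => // Hp; rewrite (count_memPn _) //.
  by apply/mapP => -[v /lv Hv Ep]; rewrite Ep Hv in Hp.
exists (fun t => count_mem t c + \sum_(p | valid p) y' p * p t).
  apply/andP; split.
    apply/eqP => /=; under eq_bigr => t _ do rewrite PoszD mulrDr.
    rewrite big_split /= -sumE Ec -sumdot big1 ?addr0 // => p _.
    by rewrite /dot /valid; case: eqP => [->|_]; rewrite mul0r.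
  move: Hy'; rewrite all_map; apply: sub_all => e /eqP /= He; apply/eqP.
  under eq_bigr => t _ do rewrite PoszD mulrDr.
  by rewrite big_split /= -sumdot He addrC subrK.
move=> t; apply: leq_add; first exact: leq_trans (count_size _ _) Hc.
rewrite -/K; set F := ilp_bound _ _ _.
have cardU : #|U| = K.+1 ^ #|T| by rewrite card_ffun card_ord.
apply: (@leq_trans (\sum_(p : U) K * F)).
  rewrite big_mkcond; apply: leq_sum => p _; case: ifP => // _.
  rewrite mulnC leq_mul //; first by rewrite -ltnS.
  by have := By' p; rewrite cardU.
by rewrite sum_nat_const cardU mulnA.
Qed.

(** Substituting [z + 1] on the support of [x] and 0 elsewhere fixes the support. This moves the
    right-hand sides by at most [#|T| * M] and the final bound by 1. *)
Lemma small_solution_support (T : finType) (M : nat) (eqs : seq (equation T))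
    (x : T -> nat) :
  (forall i, i < size eqs -> eq_bounded M (nth ((fun=> 0%R), 0%R) eqs i)) ->
  all (solves x) eqs ->
  exists y, [/\ all (solves y) eqs, forall t, (0 < y t) = (0 < x t)
    & forall t, y t <= (ilp_bound (size eqs) #|T| (M + #|T| * M)).+1].
Proof.
move=> HM Heqs.
pose shift (e : equation T) : equation T :=
  ((fun t => if (0 < x t)%N then e.1 t else 0%R), (e.2 - \sum_(t | (0 < x t)%N) e.1 t)%R).
have shiftE (z : T -> nat) e :
    solves (fun t => if 0 < x t then (z t).+1 else 0) e = solves z (shift e).
  rewrite /solves /=; apply/eqP/eqP => [<-|].
    rewrite [X in (_ = _ - X)%R]big_mkcond -sumrB; apply: eq_bigr => t _.
    by case: ifP => _; rewrite ?mul0r ?mulr0 ?subr0 // -addn1 PoszD mulrDr mulr1 addrK.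
  move/eqP; rewrite eq_sym subr_eq => /eqP ->; rewrite [X in (_ = _ + X)%R]big_mkcond.
  rewrite -big_split; apply: eq_bigr => t _ /=.
  by case: ifP => _; rewrite ?mul0r ?mulr0 ?addr0 // -addn1 PoszD mulrDr mulr1.
have [||y Hy By] := @small_solution _ (M + #|T| * M) (map shift eqs) (fun t => (x t).-1).
- move=> i; rewrite size_map => Hi; rewrite (nth_map ((fun=> 0%R), 0%R)) //.
  have [eM eb] := HM i Hi; set e := nth _ _ _ in eM eb *.
  split=> /= [t|]; first by case: ifP => _ //; apply: leq_trans (eM t) (leq_addr _ _).
  have : `|(\sum_(t | (0 < x t)%N) e.1 t)%R|%N <= #|T| * M.
    rewrite -lez_nat abszE big_mkcond; apply: (le_trans (ler_norm_sum _ _ _)).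
    rewrite -sum_nat_const -natz natr_sum; apply: ler_sum => t _; rewrite natz.
    by have := eM t; case: ifP => _; rewrite ?normr0 // -lez_nat abszE.
  by move: (#|T| * M) (\sum_(t | _) _)%R eb => B X; lia.
- rewrite all_map; apply: sub_all Heqs => e /=; rewrite -shiftE.
  by move=> H; rewrite /solves (eq_bigr (fun t => e.1 t * (x t)%:Z)%R) // => t _;
    case: (x t).
exists (fun t => if 0 < x t then (y t).+1 else 0); split=> [|t|t].
- by move: Hy; rewrite all_map; apply: sub_all => e /=; rewrite -shiftE.
- by case: ifP.
- by case: ifP => // _; rewrite ltnS; have := By t; rewrite size_map.
Qed.

(** Allows the exact cardinalities to be replaced by a bound read off the input. *)
Lemma ilp_bound_mono m n M m' n' M' :
  m <= m' -> n <= n' -> M <= M' -> ilp_bound m n M <= ilp_bound m' n' M'.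
Proof.
elim: m m' n n' M M' => [|m IH] [|m'] n n' M M' //= Hm Hn HM.
have HK : (2 * M).+1 <= (2 * M').+1 by rewrite ltnS leq_mul.
have HE : (2 * M).+2 ^ n <= (2 * M').+2 ^ n'.
  by apply: (leq_trans (leq_pexp2l _ Hn)) => //; case: n' {Hn} => // n'; rewrite leq_exp2r.
apply: leq_add => //; apply: leq_mul; first exact: leq_mul.
by apply: IH => //; rewrite leq_add // !leq_mul.
Qed.

(** * Short Dyck paths of a finite automaton *)

Section Automaton.
Variables (Q E : finType) (esrc edst : E -> Q).

Fixpoint epath (p : Q) (w : seq E) (q : Q) : bool :=
  if w is e :: w' then (esrc e == p) && epath (edst e) w' q else p == q.

Lemma epath_cat p u v q :
  epath p (u ++ v) q <-> exists2 r, epath p u r & epath r v q.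
Proof.
elim: u p => [|e u IH] p /=; first by split=> [|[r /eqP ->]]; [exists p|].
split=> [/andP[-> /IH[r Hu Hv]]|[r /andP[-> Hu] Hv]]; first by exists r.
by apply/IH; exists r.
Qed.

Definition nonterm : finType := (Q * Q)%type.

(* The nonterminal [(p, q)] stands for the paths from [p] to [q] with Dyck
   label.  The rules, in this order: empty path, concatenation, edge without
   letter, pair of matching edges. *)
Definition rule : finType := (Q + Q * Q * Q + (E + E * E))%type.

Definition rlhs (r : rule) : nonterm :=
  match r with
  | inl (inl p) => (p, p)
  | inl (inr (p, _, q)) => (p, q)
  | inr (inl e) => (esrc e, edst e)
  | inr (inr (e1, e2)) => (esrc e1, edst e2)
  end.

Definition rrhs (r : rule) : seq nonterm :=
  match r with
  | inl (inr (p, m, q)) => [:: (p, m); (m, q)]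
  | inr (inr (e1, e2)) => [:: (edst e1, esrc e2)]
  | _ => [::]
  end.

Definition redges (r : rule) : seq E :=
  match r with
  | inl _ => [::]
  | inr (inl e) => [:: e]
  | inr (inr (e1, e2)) => [:: e1; e2]
  end.

Section Label.
Variables (k : nat) (lab : E -> option (letter k)).

Definition rvalid (r : rule) : bool :=
  match r with
  | inl _ => true
  | inr (inl e) => ~~ isSome (lab e)
  | inr (inr (e1, e2)) =>
      match lab e1, lab e2 with
      | Some (Open i), Some (Close j) => i == j
      | _, _ => false
      end
  end.

Fixpoint dyck_paths (s : seq nonterm) (w : seq E) : Prop :=
  match s with
  | [::] => w = [::]
  | (p, q) :: s' => exists u v,
      [/\ w = u ++ v, epath p u q, dyck (pmap lab u) & dyck_paths s' v]
  end.

(** Equality holds only up to permutation, since a rule for a matching pair emits together two edges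
    that enclose a path. *)
Lemma derivation_dyck_paths s rs : derivation rlhs rrhs s rs -> all rvalid rs ->
  exists2 w, dyck_paths s w & perm_eq w (flatten (map redges rs)).
Proof.
elim=> {s rs} [|[[p|[[p m] q]]|[e|[e1 e2]]] s rs _ IH] /=.
- by exists [::].
- by move/IH=> [w Hs P]; exists w => //; exists [::], w; split=> //=; apply: dyck_eps.
- move/IH=> [_ [u1 [_ [-> H1 D1 [u2 [v [-> H2 D2 Hv]]]]]] P].
  exists (u1 ++ u2 ++ v) => //; exists (u1 ++ u2), v; split=> //; first by rewrite catA.
    by apply/epath_cat; exists m.
  by rewrite pmap_cat; apply: dyck_cat.
- case/andP=> Le /IH[w Hs P]; exists (e :: w); last by rewrite perm_cons.
  exists [:: e], w; split; rewrite /= ?eqxx //.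
  by case: (lab e) Le => //= _; apply: dyck_eps.
- case/andP; case E1: (lab e1) => [[i|]|] //; case E2: (lab e2) => [[|j]|] //.
  move=> /eqP Eij; rewrite -{j}Eij in E2.
  move=> /IH[_ [u [v [-> Hu Du Hv]]] P]; exists (e1 :: rcons u e2 ++ v).
    exists (e1 :: rcons u e2), v; split=> //.
      rewrite /= eqxx -cats1; apply/epath_cat; exists (esrc e2) => //=.
      by rewrite !eqxx.
    by rewrite /= E1 -cats1 pmap_cat /= E2 cats1; apply: dyck_wrap.
  by rewrite perm_cons cat_rcons -cat1s perm_catCA /= perm_cons.
Qed.

Definition edge_count (x : rule -> nat) (e : E) : nat :=
  \sum_r x r * count_mem e (redges r).

Definition represents (p q : Q) (w : seq E) (x : rule -> nat) : Prop :=
  [/\ flow rlhs rrhs [:: (p, q)] x, forall r, 0 < x r -> rvalid r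
    & forall e, count_mem e w = edge_count x e].

Lemma represents_rule r w x :
  flow rlhs rrhs (rrhs r) x -> (forall r', 0 < x r' -> rvalid r') -> rvalid r ->
  (forall e, count_mem e w = count_mem e (redges r) + edge_count x e) ->
  represents (rlhs r).1 (rlhs r).2 w (use_rule r x).
Proof.
move=> F Vx Vr Hw; split.
- by rewrite -surjective_pairing; apply: flow_use_rule.
- by move=> r'; rewrite /use_rule; case: eqP => [->|_] //; rewrite addn0; apply: Vx.
- by move=> e; rewrite Hw /edge_count sum_use_rule.
Qed.

Lemma flow_nil : flow rlhs rrhs [::] (fun=> 0).
Proof. by split=> // A; rewrite !big1. Qed.

Lemma edge_count0 e : edge_count (fun=> 0) e = 0.
Proof. by rewrite /edge_count big1. Qed.

Lemma represents_nil p : exists x, represents p p [::] x.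
Proof.
exists (use_rule (inl (inl p)) (fun=> 0)).
by apply: (@represents_rule (inl (inl p))) flow_nil _ _ _ => // e; rewrite edge_count0.
Qed.

Lemma represents_cat p m q u v : (exists x, represents p m u x) ->
  (exists x, represents m q v x) -> exists x, represents p q (u ++ v) x.
Proof.
move=> [x [Fx Vx Ex]] [y [Fy Vy Ey]].
exists (use_rule (inl (inr (p, m, q))) (fun r => x r + y r)).
apply: (@represents_rule (inl (inr (p, m, q)))) => //.
- exact: (flow_cat Fx Fy).
- by move=> r; rewrite addn_gt0 => /orP[/Vx|/Vy].
- move=> e; rewrite count_cat Ex Ey add0n /edge_count -big_split.
  by apply: eq_bigr => r _; rewrite mulnDl.
Qed.

Lemma represents_edge e : lab e = None -> exists x, represents (esrc e) (edst e) [:: e] x.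
Proof.
move=> He; exists (use_rule (inr (inl e)) (fun=> 0)).
apply: (@represents_rule (inr (inl e))) flow_nil _ _ _ => //=; first by rewrite He.
by move=> e'; rewrite edge_count0 !addn0.
Qed.

Lemma represents_silent p u q : epath p u q -> pmap lab u = [::] ->
  exists x, represents p q u x.
Proof.
elim: u p => [|e u IH] p /=; first by move/eqP=> -> _; apply: represents_nil.
case/andP=> /eqP <-; case Ee: (lab e) => [//|] /= /IH H /H.
by rewrite -cat1s; apply: represents_cat; apply: represents_edge.
Qed.

Lemma pmap_catP (f : E -> option (letter k)) u w1 w2 : pmap f u = w1 ++ w2 ->
  exists u1 u2, [/\ u = u1 ++ u2, pmap f u1 = w1 & pmap f u2 = w2].
Proof.
elim: u w1 => [|e u IH] w1 /=.
  by case: w1 => //= <-; exists [::], [::].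
case Ee: (f e) => [a|] /=.
  case: w1 => [/= <-|b w1 [<- /IH[u1 [u2 [-> <- <-]]]]].
    by exists [::], (e :: u); rewrite /= Ee.
  by exists (e :: u1), u2; rewrite /= Ee.
move=> /IH[u1 [u2 [-> <- <-]]]; by exists (e :: u1), u2; rewrite /= Ee.
Qed.

Lemma pmap_consP (f : E -> option (letter k)) u a w : pmap f u = a :: w ->
  exists u1 e u2, [/\ u = u1 ++ e :: u2, pmap f u1 = [::], f e = Some a & pmap f u2 = w].
Proof.
elim: u => //= e u IH; case Ee: (f e) => [b|] /=.
  by case=> <- <-; exists [::], e, u.
move=> /IH[u1 [e' [u2 [-> H1 H2 H3]]]].
by exists (e :: u1), e', u2; split=> //=; rewrite Ee.
Qed.

(** Induction on the Dyck word, cutting the path at its letters. For a bracketed word the silent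
    edges before the opening and after the closing letter are split off; those inside belong to the
    inner path. *)
Lemma dyck_represents p u q : epath p u q -> dyck (pmap lab u) ->
  exists x, represents p q u x.
Proof.
move=> Hp D; move Ew: (pmap lab u) D => w D.
elim: D p u q Hp Ew => {w} [|w1 w2 _ IH1 _ IH2|i w _ IH] p u q Hp Ew.
- exact: represents_silent Ew.
- have [u1 [u2 [Eu E1 E2]]] := pmap_catP Ew; rewrite Eu in Hp *.
  have [m Hp1 Hp2] := (epath_cat _ _ _ _).1 Hp.
  by apply: represents_cat; [exact: IH1 Hp1 E1 | exact: IH2 Hp2 E2].
- have [u1 [e1 [u2 [Eu E1 L1 Ew2]]]] := pmap_consP Ew.
  rewrite -cats1 in Ew2; have [u3 [u4 [Eu2 E3 E4]]] := pmap_catP Ew2.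
  have [u5 [e2 [u6 [Eu4 E5 L2 E6]]]] := pmap_consP E4.
  move: Hp; rewrite {}Eu {}Eu2 {}Eu4 => /epath_cat[p1 Hp1].
  case/andP=> /eqP Ep1 /epath_cat[p2 Hp2 /epath_cat[p3 Hp3 /andP[/eqP Ep3 Hp4]]].
  apply: represents_cat; first exact: represents_silent Hp1 E1.
  have -> : e1 :: u3 ++ u5 ++ e2 :: u6 = (e1 :: rcons (u3 ++ u5) e2) ++ u6.
    by rewrite /= cat_rcons catA.
  apply: (@represents_cat _ (edst e2)); last exact: represents_silent Hp4 E6.
  have [||x [Fx Vx Ex]] := IH (edst e1) (u3 ++ u5) (esrc e2).
  + by apply/epath_cat; exists p2 => //; rewrite Ep3.
  + by rewrite pmap_cat E3 E5 cats0.
  exists (use_rule (inr (inr (e1, e2))) x); rewrite -Ep1.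
  apply: (@represents_rule (inr (inr (e1, e2)))) => //=; first by rewrite L1 L2.
  by move=> e; rewrite -cats1 count_cat Ex /=; lia.
Qed.

(** The counts come from an actual derivation, from which a Dyck path is read off; it shares its
    edge counts with [w] but may be a different path. *)
Lemma represents_dyck p q (w : seq E) x : represents p q w x ->
  exists u, [/\ epath p u q, dyck (pmap lab u) & perm_eq u w].
Proof.
move=> [Fx Vx Ex]; have [rs D Crs] := flow_derivation Fx.
have [|u] := derivation_dyck_paths D.
  by apply/allP => r Hr; apply: Vx; rewrite -Crs -has_count has_pred1.
case=> v [_ [-> Hv Dv ->]]; rewrite cats0 => P; exists v; split=> //.
rewrite (permPl P) /perm_eq; apply/allP => e _ /=; apply/eqP.
rewrite Ex /edge_count count_flatten -map_comp sumnE big_map.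
rewrite (sum_countn (fun r => count_mem e (redges r))).
by apply: eq_bigr => r _; rewrite Crs.
Qed.

End Label.
End Automaton.

(** [n] bounds the numbers of states and of edges, [r] that of rules. There are two unknowns per
    rule, one balance equation per nonterminal for each alphabet and one equation per edge.
    Coefficients are at most 2, the last argument of [ilp_bound] comes from
    [small_solution_support], and the outer 2 from the at most two edges of a rule. *)
Definition path_bound (n : nat) : nat :=
  let r := n + n * n * n + (n + n * n) in
  2 * (r * (ilp_bound (n * n + (n * n + n)) (r + r) (2 + (r + r) * 2)).+1).

(** * Two Dyck conditions coupled by their edge counts *)

Section TwoLabels.
Variables (Q E : finType) (esrc edst : E -> Q) (ka kb : nat).
Variables (laba : E -> option (letter ka)) (labb : E -> option (letter kb)).
Local Notation R := (rule Q E).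
Local Notation lhs := (rlhs esrc edst).
Local Notation rhs := (rrhs esrc edst).

Definition balance_coef (A : nonterm Q) (r : R) : int :=
  ((count_mem A (rhs r))%:Z - (lhs r == A)%:Z)%R.

Lemma balanced_solves (x : R -> nat) s : balanced lhs rhs s x <->
  forall A, (\sum_r balance_coef A r * (x r)%:Z = - (count_mem A s)%:Z)%R.
Proof.
have E1 A : (\sum_r balance_coef A r * (x r)%:Z =
    (\sum_r x r * count_mem A (rhs r))%N%:Z - (\sum_r x r * (lhs r == A))%N%:Z)%R.
  rewrite -![Posz (bigop _ _ _)]natz !natr_sum -sumrB; apply: eq_bigr => r _.
  by rewrite !natz /balance_coef mulrBl !PoszM ![(_ * Posz (x r))%R]mulrC.
by split=> H A; have := H A; rewrite E1; lia.
Qed.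

Definition balance_eqs (b : bool) (p q : Q) : seq (equation (R + R)%type) :=
  [seq ((fun t => match t, b with
                  | inl r, true | inr r, false => balance_coef A r
                  | _, _ => 0%R
                  end), (- (A == (p, q))%:Z)%R) | A <- enum {: nonterm Q}].

Definition edge_eqs : seq (equation (R + R)%type) :=
  [seq ((fun t => match t with
                  | inl r => (count_mem e (redges r))%:Z
                  | inr r => - (count_mem e (redges r))%:Z
                  end)%R, 0%R) | e <- enum E].

Definition system (p q : Q) : seq (equation (R + R)%type) :=
  balance_eqs true p q ++ (balance_eqs false p q ++ edge_eqs).

Lemma solves_system p q (z : R + R -> nat) : all (solves z) (system p q) <->
  [/\ balanced lhs rhs [:: (p, q)] (z \o inl), balanced lhs rhs [:: (p, q)] (z \o inr)
    & forall e, edge_count (z \o inl) e = edge_count (z \o inr) e].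
Proof.
have B b : all (solves z) (balance_eqs b p q) <->
    balanced lhs rhs [:: (p, q)] (if b then z \o inl else z \o inr).
  have D A : solves z ((fun t => match t, b with
        | inl r, true | inr r, false => balance_coef A r
        | _, _ => 0%R
        end), (- (A == (p, q))%:Z)%R) =
      (\sum_r balance_coef A r * ((if b then z \o inl else z \o inr) r)%:Z ==
       - (count_mem A [:: (p, q)])%:Z)%R.
    rewrite /solves /= big_sumType /= addn0 [(p, q) == A]eq_sym.
    case: b; first by rewrite [X in (_ + X)%R]big1 ?addr0 // => r _; rewrite mul0r.
    by rewrite [X in (X + _)%R]big1 ?add0r // => r _; rewrite mul0r.
  rewrite balanced_solves all_map; split=> [/allP H A|H].
    by have := H A (mem_enum _ _); rewrite /= D => /eqP.
  by apply/allP => A _; rewrite /= D H.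
have C : all (solves z) edge_eqs <->
    forall e, edge_count (z \o inl) e = edge_count (z \o inr) e.
  have D e : (\sum_r (count_mem e (redges r))%:Z * (z (inl r))%:Z +
      \sum_r - (count_mem e (redges r))%:Z * (z (inr r))%:Z =
      (edge_count (z \o inl) e)%:Z - (edge_count (z \o inr) e)%:Z)%R.
    rewrite -![Posz (edge_count _ _)]natz !natr_sum -sumrN; congr (_ + _)%R.
      by apply: eq_bigr => r _; rewrite natz PoszM mulrC.
    by apply: eq_bigr => r _; rewrite natz PoszM mulNr mulrC.
  rewrite all_map; split=> [/allP H e|H].
    by have := H e (mem_enum _ _); rewrite /solves /= big_sumType /= D subr_eq0 => /eqP[].
  by apply/allP => e _; rewrite /solves /= big_sumType /= D H subrr.
rewrite !all_cat; split.
  by case/and3P => /B H1 /B H2 /C H3.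
by case=> H1 H2 H3; apply/and3P; split; [apply/B | apply/B | apply/C].
Qed.

Lemma size_balance_eqs b p q : size (balance_eqs b p q) = #|Q| * #|Q|.
Proof. by rewrite size_map -cardE card_prod. Qed.

Lemma size_edge_eqs : size edge_eqs = #|E|.
Proof. by rewrite size_map -cardE. Qed.

Lemma size_system p q : size (system p q) = #|Q| * #|Q| + (#|Q| * #|Q| + #|E|).
Proof. by rewrite !size_cat !size_balance_eqs size_edge_eqs. Qed.

Lemma system_bounded p q i : i < size (system p q) ->
  eq_bounded 2 (nth ((fun=> 0%R), 0%R) (system p q) i).
Proof.
have cr e (r : R) : count_mem e (redges r) <= 2.
  by apply: leq_trans (count_size _ _) _; case: r => [|[|[]]].
have ca A r : `|balance_coef A r|%N <= 2.
  have : count_mem A (rhs r) <= 2.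
    by apply: leq_trans (count_size _ _) _; case: r => [[|[[]]]|[|[]]].
  by rewrite /balance_coef; case: eqP; lia.
have Hb b j : j < size (balance_eqs b p q) ->
    eq_bounded 2 (nth ((fun=> 0%R), 0%R) (balance_eqs b p q) j).
  rewrite size_map -cardE => Hj; rewrite (nth_map (p, q)) -?cardE //.
  split=> /= [[r|r]|]; [case: b {Hj} => //; exact: ca | case: b {Hj} => //; exact: ca|].
  by case: eqP.
rewrite !size_cat => Hi; rewrite nth_cat; case: ltnP => [|Hi1]; first exact: Hb.
rewrite nth_cat; case: ltnP => [|Hi2]; first exact: Hb.
set j := _ - _; have Hj : j < size (enum E).
  move: Hi Hi1 Hi2; rewrite /j size_edge_eqs -cardE !size_balance_eqs.
  by move: (#|Q| * #|Q|) #|E| => a b; lia.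
have [e _] : exists2 e : E, e \in enum E & true.
  by case: (enum E) Hj => // e l _; exists e; rewrite ?inE ?eqxx.
by rewrite (nth_map e) //; split=> //= -[r|r]; rewrite ?abszN; apply: cr.
Qed.

(** Accessibility depends only on the support, which the small solution shares with the flows of
    [w]; so both of its halves are again flows. They agree on edge counts only, hence two paths. *)
Lemma short_dyck_paths p q w n :
  epath esrc edst p w q -> dyck (pmap laba w) -> dyck (pmap labb w) ->
  #|Q| <= n -> #|E| <= n ->
  exists u v, [/\ epath esrc edst p u q /\ dyck (pmap laba u),
    epath esrc edst p v q /\ dyck (pmap labb v), perm_eq u v & size u <= path_bound n].
Proof.
move=> Hw Da Db Qn En.
have [x [[Bx Cx] Vx Ex]] := dyck_represents Hw Da.
have [y [[By Cy] Vy Ey]] := dyck_represents Hw Db.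
pose z (t : R + R) := match t with inl r => x r | inr r => y r end.
have Hz : all (solves z) (system p q).
  by apply/solves_system; split=> // e; rewrite -Ex -Ey.
have [z' [Hz' Sz' Bz']] := small_solution_support (@system_bounded p q) Hz.
have [Bx' By' Exy] := (solves_system p q z').1 Hz'.
pose F := ilp_bound (n * n + (n * n + n))
  ((n + n * n * n + (n + n * n)) + (n + n * n * n + (n + n * n)))
  (2 + ((n + n * n * n + (n + n * n)) + (n + n * n * n + (n + n * n))) * 2).
have cardR : #|R| <= n + n * n * n + (n + n * n).
  by rewrite !card_sum !card_prod !leq_add // !leq_mul.
have zF t : z' t <= F.+1.
  apply: leq_trans (Bz' t) _; rewrite ltnS size_system; apply: ilp_bound_mono.
  - by rewrite !leq_add // !leq_mul.
  - by rewrite card_sum !leq_add.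
  - by rewrite leq_add2l leq_mul // card_sum leq_add.
have Ru u : perm_eq u (flatten [seq nseq (edge_count (z' \o inl) e) e | e <- enum E]) ->
    forall e, count_mem e u = edge_count (z' \o inl) e.
  by move=> /permP H e; rewrite H; apply: count_flatten_nseq.
(* Not a path, just some sequence with the prescribed edge counts. *)
set u0 := flatten _ in Ru.
have ra : represents esrc edst laba p q u0 (z' \o inl).
  split; last exact: Ru.
    split=> // r Hr; apply: accessible_sub (Cx r _) => //; last by rewrite -(Sz' (inl r)).
    by move=> r' Hr'; rewrite /= (Sz' (inl r')).
  by move=> r Hr; apply: Vx; rewrite -(Sz' (inl r)).
have rb : represents esrc edst labb p q u0 (z' \o inr).
  split; last by move=> e; rewrite -Exy; apply: Ru.
    split=> // r Hr; apply: accessible_sub (Cy r _) => //; last by rewrite -(Sz' (inr r)).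
    by move=> r' Hr'; rewrite /= (Sz' (inr r')).
  by move=> r Hr; apply: Vy; rewrite -(Sz' (inr r)).
have [u [Hu Du Pu]] := represents_dyck ra.
have [v [Hv Dv Pv]] := represents_dyck rb.
exists u, v; split=> //; first by rewrite (permPl Pu) perm_sym.
have sizeE (s : seq E) : size s = \sum_e count_mem e s.
  by rewrite -sum1_size sum_countn; apply: eq_bigr => e _; rewrite muln1.
rewrite sizeE; under eq_bigr => e _ do rewrite (Ru _ Pu).
rewrite exchange_big /=.
under eq_bigr => r _ do rewrite -big_distrr /= -sizeE.
rewrite /path_bound mulnC -mulnA.
apply: leq_trans (_ : #|R| * (F.+1 * 2) <= _); last by rewrite leq_mul2r cardR orbT.
rewrite -sum_nat_const; apply: leq_sum => r _; apply: leq_mul => //.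
by case: r => [|[|[]]].
Qed.

End TwoLabels.

(** * The automaton of an item sequence *)

(** Equips letters with equality and choice, so that the edges in use form a finite type. *)
Definition letter_sum k (a : letter k) : 'I_k + 'I_k :=
  match a with Open i => inl i | Close i => inr i end.

Definition sum_letter k (s : 'I_k + 'I_k) : letter k :=
  match s with inl i => Open i | inr i => Close i end.

Lemma letter_sumK k : cancel (@letter_sum k) (@sum_letter k).
Proof. by case. Qed.

HB.instance Definition _ k := Countable.copy (letter k) (can_type (@letter_sumK k)).

Section ItemAutomaton.
Variable A : choiceType.
Implicit Types (l : seq (item A)) (v : seq A).

Definition edge : Type := (nat * option A * nat)%type.
Implicit Types (e : edge) (w : seq edge).

Fixpoint word_edges (s : nat) v : seq edge :=
  if v is a :: v' then (s, Some a, s.+1) :: word_edges s.+1 v' else [::].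

(** The silent back edge is passed once per iteration, even if [v] is empty, so its number of
    occurrences is the loop count. *)
Definition cycle_edges (s : nat) v : seq edge :=
  rcons (word_edges s v) (s + size v, None, s).

(** The exit edge of a loop starts at its first state: a path can leave only between iterations, and
    never returns. *)
Fixpoint automaton (s : nat) l : seq edge :=
  match l with
  | [::] => [::]
  | inl a :: l' => (s, Some a, s.+1) :: automaton s.+1 l'
  | inr v :: l' => cycle_edges s v ++
      (s, None, (s + size v).+1) :: automaton (s + size v).+1 l'
  end.

Fixpoint final (s : nat) l : nat :=
  match l with
  | [::] => s
  | inl _ :: l' => final s.+1 l'
  | inr v :: l' => final (s + size v).+1 l'
  end.

Fixpoint npath (p : nat) w (q : nat) : bool :=
  if w is e :: w' then (e.1.1 == p) && npath e.2 w' q else p == q.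

Lemma npath_cat p u w q m : npath p u m -> npath m w q -> npath p (u ++ w) q.
Proof. by elim: u p => [|e u IH] p /= => [/eqP -> //|/andP[-> Hu] Hw]; apply: IH. Qed.

Lemma npath_word_edges s v : npath s (word_edges s v) (s + size v).
Proof. by elim: v s => [|a v IH] s /=; rewrite ?addn0 // eqxx -addSnnS IH. Qed.

Lemma npath_cycle s v : npath s (cycle_edges s v) s.
Proof.
rewrite /cycle_edges -cats1; apply: npath_cat (npath_word_edges _ _) _.
by rewrite /= !eqxx.
Qed.

Lemma pmap_word_edges s v : pmap (fun e => e.1.2) (word_edges s v) = v.
Proof. by elim: v s => //= a v IH s; rewrite IH. Qed.

Lemma pmap_cycle s v : pmap (fun e => e.1.2) (cycle_edges s v) = v.
Proof. by rewrite /cycle_edges -cats1 pmap_cat pmap_word_edges cats0. Qed.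

Lemma word_edgesP s v e : e \in word_edges s v ->
  exists v1 a v2, v = v1 ++ a :: v2 /\ e = (s + size v1, Some a, (s + size v1).+1).
Proof.
elim: v s => //= a v IH s; rewrite inE => /predU1P[->|/IH[v1 [b [v2 [-> ->]]]]].
  by exists [::], a, v; rewrite addn0.
by exists (a :: v1), b, v2; rewrite /= addnS addSn.
Qed.

Lemma leq_final s l : s <= final s l.
Proof.
elim: l s => //= -[a|v] l IH s; first exact: ltnW (IH _).
by apply: leq_trans (IH _); rewrite -addnS leq_addr.
Qed.

Lemma automaton_bounds s l e : e \in automaton s l ->
  [/\ s <= e.1.1, s <= e.2, e.1.1 <= final s l & e.2 <= final s l].
Proof.
elim: l s => //= -[a|v] l IH s; have := leq_final; [move/(_ s.+1 l) | move/(_ (s + size v).+1 l)] => F.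
  rewrite inE => /predU1P[->|/IH[]] /=; first by split=> //; lia.
  by move=> ????; split=> //; lia.
rewrite mem_cat mem_rcons !inE => /or3P[/predU1P[->|]|/eqP ->|/IH[]] /=.
- by split; lia.
- case/word_edgesP => v1 [a [v2 [Ev ->]]]; have := congr1 size Ev.
  by rewrite size_cat /=; move: F; move: (final _ _) => f F H; split; lia.
- by split; lia.
- by move=> ????; split=> //; lia.
Qed.

Lemma automaton_word sigma j s l : exists w,
  [/\ npath s w (final s l), {subset w <= automaton s l}
    & pmap (fun e => e.1.2) w = words sigma j l].
Proof.
elim: l s j => [|[a|v] l IH] s j /=; first by exists [::]; split=> //=.
  have [w [Hw Sw <-]] := IH s.+1 j; exists ((s, Some a, s.+1) :: w).
  split=> //=; first by rewrite eqxx.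
  by move=> e; rewrite !inE => /predU1P[->|/Sw ->]; rewrite ?eqxx ?orbT.
have [w [Hw Sw <-]] := IH (s + size v).+1 j.+1.
exists (flatten (nseq (sigma j) (cycle_edges s v)) ++ (s, None, (s + size v).+1) :: w).
split.
- apply: (@npath_cat _ _ _ _ s); last by rewrite /= eqxx.
  elim: (sigma j) => [|n IHn] /=; first exact: eqxx.
  exact: npath_cat (npath_cycle _ _) IHn.
- move=> e; rewrite !mem_cat !inE => /or3P[/flattenP[c /nseqP[-> _] ->] //|->|/Sw ->].
    by rewrite orbT.
  by rewrite !orbT.
- rewrite pmap_cat /=; congr (_ ++ _).
  by elim: (sigma j) => //= n IHn; rewrite pmap_cat pmap_cycle IHn.
Qed.

(** Used to show that after leaving an item a path meets only edges of later items. *)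
Lemma path_bound_src p w q (X : seq edge) (m : nat) : npath p w q ->
  {subset w <= X} -> m <= p ->
  (forall e, e \in X -> m <= e.1.1 -> m <= e.2) -> forall e, e \in w -> m <= e.1.1.
Proof.
move=> + + + HX; elim: w p => //= e w IH p /andP[/eqP <- Hw] Sw Hm e'.
have He : e \in X by apply: Sw; rewrite inE eqxx.
rewrite inE => /predU1P[-> //|]; apply: IH Hw _ _ _; last exact: HX.
by move=> d Hd; apply: Sw; rewrite inE Hd orbT.
Qed.

Lemma plain_path s a l w q : npath s w q -> {subset w <= automaton s (inl a :: l)} ->
  s.+1 <= q -> exists w', [/\ w = (s, Some a, s.+1) :: w', npath s.+1 w' q
    & {subset w' <= automaton s.+1 l}].
Proof.
case: w => [|e w] /=; first by move=> /eqP -> _; rewrite ltnn.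
case/andP=> /eqP Es Hw Sw _.
have : e \in automaton s (inl a :: l) by apply: Sw; rewrite inE eqxx.
rewrite inE => /predU1P[Ee|/automaton_bounds[]]; last by rewrite Es ltnn.
rewrite Ee in Hw *; exists w; split=> // e' He'.
have : s.+1 <= e'.1.1.
  apply: (path_bound_src Hw (X := automaton s (inl a :: l))) => //.
    by move=> d Hd; apply: Sw; rewrite inE Hd orbT.
  by move=> d; rewrite inE => /predU1P[->|/automaton_bounds[]].
have : e' \in automaton s (inl a :: l) by apply: Sw; rewrite inE He' orbT.
by rewrite inE => /predU1P[->|//]; rewrite ltnn.
Qed.

(** A path that has read [v1] inside a loop is forced to complete the iteration, as its end lies
    beyond the loop; at the first state of the loop the exit edge has to be excluded. *)
Lemma follow_cycle s v1 v2 l w q : npath (s + size v1) w q ->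
  {subset w <= automaton s (inr (v1 ++ v2) :: l)} -> s + size (v1 ++ v2) < q ->
  (0 < size v1) || (ohead w != Some (s, None, (s + size (v1 ++ v2)).+1)) ->
  exists w', [/\ w = rcons (word_edges (s + size v1) v2) (s + size (v1 ++ v2), None, s) ++ w',
    npath s w' q & {subset w' <= automaton s (inr (v1 ++ v2) :: l)}].
Proof.
elim: v2 v1 w => [|a v2 IH] v1 [|e w] /=.
- by rewrite cats0 => /eqP -> _; rewrite ltnn.
- rewrite cats0 => /andP[/eqP Es Hw] Sw _ Hd.
  have : e \in automaton s (inr v1 :: l) by apply: Sw; rewrite inE eqxx.
  rewrite /= mem_cat mem_rcons !inE => /or3P[/predU1P[Ee|]|/eqP Ee|/automaton_bounds[]].
  + exists w; rewrite Ee in Hw *; split=> // d Hd'; apply: Sw; by rewrite inE Hd' orbT.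
  + by case/word_edgesP => u1 [b [u2 [Ev Ee]]]; move: Es; rewrite Ee Ev size_cat /=; lia.
  + by move: Hd; rewrite Ee eqxx orbF => Hv; exfalso; move: Es; rewrite Ee /=; lia.
  + by rewrite Es ltnn.
- by move=> /eqP <- _; rewrite size_cat /=; lia.
- move=> /andP[/eqP Es Hw] Sw Hq Hd.
  have : e \in automaton s (inr (v1 ++ a :: v2) :: l) by apply: Sw; rewrite inE eqxx.
  rewrite /= mem_cat mem_rcons !inE => /or3P[/predU1P[Ee|]|/eqP Ee|/automaton_bounds[]].
  + by exfalso; move: Es; rewrite Ee /= size_cat /=; lia.
  + case/word_edgesP => u1 [b [u2 [Ev Ee]]].
    have Eu : size u1 = size v1 by move: Es; rewrite Ee /=; lia.
    have [E1 [E2 E3]] : v1 = u1 /\ a :: v2 = b :: u2.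
      have := congr1 (take (size u1)) Ev; have := congr1 (drop (size u1)) Ev.
      by rewrite Eu !take_size_cat // !drop_size_cat // -Eu ?take_size_cat ?drop_size_cat.
    subst u1 b u2; rewrite Ee /= in Hw *.
    have [||||w' [-> Hw' Sw']] := IH (rcons v1 a) w.
    * by rewrite size_rcons addnS.
    * by rewrite cat_rcons => d Hd'; apply: Sw; rewrite inE Hd' orbT.
    * by rewrite cat_rcons.
    * by rewrite size_rcons.
    rewrite cat_rcons in Sw' *; rewrite size_rcons addnS.
    by exists w'.
  + by move: Hd; rewrite Ee eqxx orbF => Hv; exfalso; move: Es; rewrite Ee /=; lia.
  + by rewrite Es => H; exfalso; move: H; rewrite size_cat /=; lia.
Qed.

Lemma loop_path s v l w q : npath s w q -> {subset w <= automaton s (inr v :: l)} ->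
  s + size v < q -> exists n w',
    [/\ w = flatten (nseq n (cycle_edges s v)) ++ (s, None, (s + size v).+1) :: w',
      npath (s + size v).+1 w' q & {subset w' <= automaton (s + size v).+1 l}].
Proof.
have [n] := ubnP (size w); elim: n w => // n IH w Hn Hw Sw Hq.
have [|] := boolP (ohead w == Some (s, None, (s + size v).+1)).
  case: w Hn Hw Sw => //= e w _ /andP[_ Hw] Sw /eqP[Ee]; rewrite Ee /= in Hw.
  exists 0, w; rewrite Ee; split=> // e' He'.
  have : (s + size v).+1 <= e'.1.1.
    apply: (path_bound_src Hw (X := automaton s (inr v :: l))) => //.
      by move=> d Hd; apply: Sw; rewrite inE Hd orbT.
    move=> d; rewrite mem_cat mem_rcons !inE => /or3P[/predU1P[->|]|/eqP ->|/automaton_bounds[]] //=.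
      by rewrite ltnn.
    by case/word_edgesP => u1 [b [u2 [-> ->]]]; rewrite size_cat /=; lia.
  have : e' \in automaton s (inr v :: l) by apply: Sw; rewrite inE He' orbT.
  rewrite /= mem_cat mem_rcons !inE => /or3P[/predU1P[->|]|/eqP ->|//] /=.
  + by rewrite ltnn.
  + by case/word_edgesP => u1 [b [u2 [-> ->]]]; rewrite size_cat /=; lia.
  + by lia.
move=> Hd; have [||||w1 [Ew Hw1 Sw1]] := @follow_cycle s [::] v l w q => //.
  by rewrite addn0.
rewrite /= addn0 -/(cycle_edges s v) in Ew.
have [|m [w' [Ew1 Hw' Sw']]] := IH w1 _ Hw1 Sw1 Hq.
  by move: Hn; rewrite Ew size_cat size_rcons; lia.
by exists m.+1, w'; rewrite /= -catA -Ew1.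
Qed.

Lemma automaton_path_word s l w j : npath s w (final s l) ->
  {subset w <= automaton s l} ->
  exists sigma, pmap (fun e => e.1.2) w = words sigma j l.
Proof.
elim: l s w j => [|[a|v] l IH] s w j Hw Sw.
- case: w Sw {Hw} => [|e w Sw]; first by exists (fun=> 0).
  by have := Sw e; rewrite inE eqxx => /(_ isT).
- have [|w' [-> Hw' Sw']] := plain_path Hw Sw; first exact: leq_final.
  by have [sigma E] := IH _ _ j Hw' Sw'; exists sigma; rewrite /= E.
- have [|n [w' [-> Hw' Sw']]] := loop_path Hw Sw; first exact: leq_final.
  have [sigma E] := IH _ _ j.+1 Hw' Sw'.
  exists (fun i => if i == j then n else sigma i).
  rewrite pmap_cat /= E eqxx; congr (_ ++ _).
    by elim: (n) => //= m IHm; rewrite pmap_cat pmap_cycle IHm.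
  by apply: eq_words => i; case: eqP => // -> ; rewrite ltnn.
Qed.

Lemma count_back s v : count_mem (s + size v, None, s) (cycle_edges s v) = 1.
Proof.
rewrite /cycle_edges -cats1 count_cat /= eqxx (count_memPn _) //.
by apply/negP => /word_edgesP[? [? [? [_]]]].
Qed.

(** The count of the back edge of the first loop gives its number of iterations, equal for both
    paths; the common prefix cancels and the later items follow by induction. *)
Lemma automaton_path_unique s l w1 w2 : npath s w1 (final s l) ->
  npath s w2 (final s l) -> {subset w1 <= automaton s l} ->
  {subset w2 <= automaton s l} -> perm_eq w1 w2 -> w1 = w2.
Proof.
elim: l s w1 w2 => [|[a|v] l IH] s w1 w2 H1 H2 S1 S2 P.
- case: w1 S1 P {H1} => [_|e w S]; last by have := S e; rewrite inE eqxx => /(_ isT).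
  by rewrite perm_sym => /perm_nilP.
- have [|w1' [E1 H1' S1']] := plain_path H1 S1; first exact: leq_final.
  have [|w2' [E2 H2' S2']] := plain_path H2 S2; first exact: leq_final.
  move: P; rewrite E1 E2 perm_cons => /(IH _ _ _ H1' H2' S1' S2').
  by move=> ->.
- have [|n1 [w1' [E1 H1' S1']]] := loop_path H1 S1; first exact: leq_final.
  have [|n2 [w2' [E2 H2' S2']]] := loop_path H2 S2; first exact: leq_final.
  have cnt n (w : seq edge) : {subset w <= automaton (s + size v).+1 l} ->
      count_mem (s + size v, None, s) (flatten (nseq n (cycle_edges s v)) ++
        (s, None, (s + size v).+1) :: w) = n.
    move=> Sw; have w0 : count_mem (s + size v, None, s) w = 0.
      apply/count_memPn/negP => /Sw/automaton_bounds[] /=; lia.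
    rewrite count_cat /= w0.
    rewrite (_ : (_ == _) = false); last by apply/eqP => -[]; lia.
    rewrite !addn0; elim: n => //= n IHn; by rewrite count_cat IHn count_back.
  have En : n1 = n2 by rewrite -(cnt n1 _ S1') -(cnt n2 _ S2') -E1 -E2; apply/permP.
  move: P; rewrite E1 E2 -En perm_cat2l perm_cons => /(IH _ _ _ H1' H2' S1' S2').
  by move=> ->.
Qed.

(** A loop has two edges besides those of its letters, back and exit. *)
Definition item_size l : nat :=
  \sum_(it <- l) match it with inl _ => 1 | inr v => (size v).+2 end.

Lemma size_automaton s l : size (automaton s l) = item_size l.
Proof.
rewrite /item_size; elim: l s => [|[a|v] l IH] s; rewrite ?big_nil ?big_cons //= ?IH //.
rewrite size_cat size_rcons /= IH; suff -> : size (word_edges s v) = size v by lia.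
by elim: v s => //= a v IHv s; rewrite IHv.
Qed.

Lemma final_leq s l : final s l <= s + item_size l.
Proof.
rewrite /item_size; elim: l s => [|[a|v] l IH] s; rewrite ?big_nil ?big_cons ?addn0 //=.
  by apply: leq_trans (IH _) _; lia.
by apply: leq_trans (IH _) _; lia.
Qed.

End ItemAutomaton.

(** * A short word for both alphabets at once *)

Section ShortWord.
Variables (ka kb : nat) (l : seq (item (label ka kb))).

Lemma short_interleaved_word sigma : interleaved_dyck (words sigma 0 l) ->
  exists2 sigma', interleaved_dyck (words sigma' 0 l)
    & size (words sigma' 0 l) <= path_bound (item_size l).+1.
Proof.
move=> [Da Db].
pose N := final 0 l; pose E := seq_sub (undup (automaton 0 l)).
pose esrc (e : E) : 'I_N.+1 := inord (val e).1.1.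
pose edst (e : E) : 'I_N.+1 := inord (val e).2.
have esrcE e : esrc e = (val e).1.1 :> nat.
  have /automaton_bounds[_ _ H _] : val e \in automaton 0 l by rewrite -mem_undup; apply: valP.
  by rewrite inordK.
have edstE e : edst e = (val e).2 :> nat.
  have /automaton_bounds[_ _ _ H] : val e \in automaton 0 l by rewrite -mem_undup; apply: valP.
  by rewrite inordK.
have pathE (p q : 'I_N.+1) (w : seq E) : epath esrc edst p w q = npath p (map val w) q.
  by elim: w p => //= e w IH p; rewrite IH edstE -esrcE.
pose lab (e : E) := (val e).1.2.
pose laba (e : E) := obind (fun x : label ka kb => if x is inl a then Some a else None) (lab e).
pose labb (e : E) := obind (fun x : label ka kb => if x is inr b then Some b else None) (lab e).
have labE B (f : label ka kb -> option B) (w : seq E) :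
    pmap (fun e => obind f (lab e)) w = pmap f (pmap (fun e => e.1.2) (map val w)).
  by elim: w => //= e w ->; rewrite {1}/lab; case: (val e).1.2.
have subE (w : seq E) : {subset map val w <= automaton 0 l}.
  by move=> _ /mapP[e _ ->]; rewrite -mem_undup; apply: valP.
have [w0 [Hw0 Sw0 Ew0]] := automaton_word sigma 0 0 l.
have [w Ew] : exists w : seq E, map val w = w0.
  elim: w0 Sw0 {Hw0 Ew0} => [|e w0 IH] S; first by exists [::].
  have [|w <-] := IH; first by move=> d Hd; apply: S; rewrite inE Hd orbT.
  have He : e \in undup (automaton 0 l) by rewrite mem_undup; apply: S; rewrite inE eqxx.
  by exists (SeqSub He :: w).
have [|||||u [v [[Hu Du] [Hv Dv] Puv su]]] :=
  @short_dyck_paths _ _ esrc edst _ _ laba labb ord0 ord_max w (item_size l).+1.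
- by rewrite pathE Ew.
- by rewrite labE Ew Ew0.
- by rewrite labE Ew Ew0.
- by rewrite card_ord ltnS; apply: (leq_trans (final_leq _ _)).
- rewrite card_seq_sub ?undup_uniq //; apply: leq_trans (size_undup _) _.
  by rewrite size_automaton.
(* Each path satisfies one of the two Dyck conditions; being equal, they give one word that
   satisfies both. *)
have Euv : map val u = map val v.
  apply: (@automaton_path_unique _ 0 l) => //.
  - by move: Hu; rewrite pathE.
  - by move: Hv; rewrite pathE.
  - exact: perm_map.
have [sigma' Es] : exists sigma', pmap (fun e => e.1.2) (map val u) = words sigma' 0 l.
  by apply: (@automaton_path_word _ 0) => //; move: Hu; rewrite pathE.
exists sigma'; rewrite -Es.
  by split; [rewrite -[proj_alpha _]labE | rewrite Euv -[proj_beta _]labE].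
apply: leq_trans su; rewrite -(size_map val u).
by elim: (map val u) => //= e x IH; case: e.1.2 => //=; apply: leqW.
Qed.

End ShortWord.

(** * The decision program *)

(** [ilp_bound] is affine in its recursive call, so the recursion becomes a loop that accumulates
    the constant term and the factor. *)
Definition ilp_step (s : nat * (nat * (nat * nat))) : nat * (nat * (nat * nat)) :=
  (((2 * s.2.1).+2 ^ s.1), (s.2.1 + s.1 * s.2.1 * (2 * s.2.1).+1,
   (s.2.2.1 + s.2.2.2 * (2 * s.2.1).+1,
    s.2.2.2 * ((2 * s.2.1).+2 ^ s.1 * (2 * s.2.1).+1)))).

Lemma ilp_step_bound m n M a b :
  (iter m ilp_step (n, (M, (a, b)))).2.2.1 = a + b * ilp_bound m n M.
Proof.
elim: m n M a b => [|m IH] n M a b; first by rewrite muln0 addn0.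
by rewrite iterSr IH /= mulnDr addnA !mulnA.
Qed.

Lemma computable_ilp_bound X {cX : Code X} (m n M : X -> nat) :
  computable m -> computable n -> computable M ->
  computable (fun x => ilp_bound (m x) (n x) (M x)).
Proof.
move=> Hm Hn HM; apply: (@computable_ext _ _ _ _
  (fun x => (iter (m x) ilp_step (n x, (M x, (0, 1)))).2.2.1)).
  by move=> x; rewrite ilp_step_bound mul1n.
by computability; rewrite /ilp_step; computability.
Qed.

Lemma computable_path_bound X {cX : Code X} (n : X -> nat) :
  computable n -> computable (fun x => path_bound (n x)).
Proof.
by move=> Hn; rewrite /path_bound; computability; apply: computable_ilp_bound; computability.
Qed.

Lemma path_bound_mono m n : m <= n -> path_bound m <= path_bound n.
Proof.
move=> H; rewrite /path_bound leq_mul2l /=.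
have H2 : m * m <= n * n by rewrite leq_mul.
have H3 : m + m * m * m + (m + m * m) <= n + n * n * n + (n + n * n).
  by rewrite !leq_add // !leq_mul.
apply: leq_mul => //; rewrite ltnS; apply: ilp_bound_mono; by rewrite !leq_add // leq_mul // leq_add.
Qed.

Definition tree_size (t : tree) : nat := para (fun _ _ m n => (m + n).+1) 0 t.

Lemma tree_size_Cons a b : tree_size (Cons a b) = (tree_size a + tree_size b).+1.
Proof. by []. Qed.

Lemma computable_tree_size X {cX : Code X} (t : X -> tree) :
  computable t -> computable (fun x => tree_size (t x)).
Proof.
by move=> Ht; apply: (@computable_para _ _ _ _ (fun _ _ _ m n => (m + n).+1)); computability.
Qed.

(** Makes the search depth computable from the mere size of the code. *)
Lemma item_size_leq ka kb (r : regexp (label ka kb)) :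
  item_size (items r) <= tree_size (code_regexp r).
Proof.
have plain_leq (l : seq (item (label ka kb))) : size (plain_letters l) <= item_size l.
  rewrite /item_size; elim: l => [|[a|v] l IH]; rewrite ?big_nil ?big_cons //.
  by apply: leq_trans IH _; rewrite leq_addl.
rewrite /item_size in plain_leq *.
elim: r => [||c|r1 IH1 r2 IH2|r1 IH1 r2 IH2|r IH] /=; rewrite ?big_nil //.
- by rewrite big_seq1.
- rewrite big_cat; apply: leq_trans (leq_add IH1 IH2) _.
  by rewrite !tree_size_Cons -/tree_size; lia.
- rewrite big_seq1; have := leq_trans (plain_leq (items r)) IH.
  by rewrite !tree_size_Cons; move: (size _) (tree_size (code_regexp r)) => a b; lia.
Qed.

Lemma tree_size_in ka kb (P : seq (regexp (label ka kb))) r : List.In r P ->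
  tree_size (code_regexp r) <= tree_size (code_exprs P).
Proof.
elim: P => //= r' P IH [->|/IH H]; rewrite tree_size_Cons; first by rewrite leqW ?leq_addr.
by apply: leq_trans H _; rewrite leqW ?leq_addl.
Qed.

(** A node with the two stacks left by a word that leads from it to the target. *)
Definition config : Type := (nat * (seq nat * seq nat))%type.
Definition plain_edge : Type := (nat * ((bool * nlet) * nat))%type.

Definition back_step (e : plain_edge) (c : config) : seq config :=
  case_bool (c.1 == e.2.2)
    (case_bool e.2.1.1
      (case_option (bstep e.2.1.2 (Some c.2.1)) [::] (fun s => [:: (e.1, (s, c.2.2))]))
      (case_option (bstep e.2.1.2 (Some c.2.2)) [::] (fun s => [:: (e.1, (c.2.1, s))])))
    [::].

(** The old configurations are kept, so [n] rounds cover all paths of length at most [n]. *)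
Definition back_round (es : seq plain_edge) (S : seq config) : seq config :=
  foldl (fun acc c => foldl (fun acc' e => back_step e c ++ acc') acc es) S S.

Definition accepting (u : nat) (c : config) : bool :=
  case_bool (c.1 == u)
    (case_seq c.2.1 (case_seq c.2.2 true (fun _ _ => false)) (fun _ _ => false)) false.

Definition search (es : seq plain_edge) (n u v : nat) : bool :=
  foldl (fun b c => case_bool b true (accepting u c)) false
    (iter n (back_round es) [:: (v, ([::], [::]))]).

Lemma back_roundP es S c : reflect
  (c \in S \/ exists2 d, d \in S & exists2 e, e \in es & c \in back_step e d)
  (c \in back_round es S).
Proof.
rewrite /back_round; move: {1 3}S => S0.
have inner d acc : c \in foldl (fun acc' e => back_step e d ++ acc') acc es =
    (c \in acc) || has (fun e => c \in back_step e d) es.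
  by elim: es acc => [|e es IH] acc /=; rewrite ?orbF // IH mem_cat orbCA orbA.
suff -> : (c \in foldl (fun acc d => foldl (fun acc' e => back_step e d ++ acc') acc es) S0 S) =
    (c \in S0) || has (fun d => has (fun e => c \in back_step e d) es) S.
  apply: (iffP orP) => -[H|H]; [by left| |by left|]; right.
    by case/hasP: H => d Hd /hasP[e He Hc]; exists d => //; exists e.
  by case: H => d Hd [e He Hc]; apply/hasP; exists d => //; apply/hasP; exists e.
by elim: S S0 => [|d S IH] S0 /=; rewrite ?orbF // IH inner orbA.
Qed.

Lemma acceptingE u c : accepting u c = (c == (u, ([::], [::]))).
Proof.
case: c => x [s t]; rewrite /accepting /= !xpair_eqE; case: eqP => //= _.
by case: s; case: t.
Qed.

Lemma searchP es n u v :
  search es n u v = ((u, ([::], [::])) \in iter n (back_round es) [:: (v, ([::], [::]))]).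
Proof.
rewrite /search; move: (iter _ _ _) => S.
suff H b : foldl (fun b c => case_bool b true (accepting u c)) b S =
    b || ((u, ([::], [::])) \in S) by rewrite H.
elim: S b => [|c S IH] b /=; first by rewrite orbF.
by rewrite IH inE acceptingE eq_sym; case: b.
Qed.

Section Search.
Variables (ka kb : nat) (G : graph ka kb).
Implicit Types (u v x : 'I_(nodes G)) (w : seq (label ka kb)).

Definition plain_label (c : label ka kb) : bool * nlet :=
  match c with inl a => (true, nlet_of a) | inr b => (false, nlet_of b) end.

Definition plain_edges : seq plain_edge :=
  map (fun e : 'I_(nodes G) * label ka kb * 'I_(nodes G) =>
    (e.1.1 : nat, (plain_label e.1.2, e.2 : nat))) (edges G).

Lemma plain_edgesP (e : plain_edge) : e \in plain_edges <-> exists x c y,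
  List.In (x, c, y) (edges G) /\ e = (x : nat, (plain_label c, y : nat)).
Proof.
rewrite /plain_edges; elim: (edges G) => [|[[x c] y] es IH] /=.
  by split=> // -[x [c [y []]]].
rewrite inE; split.
  case/predU1P => [->|/IH[x' [c' [y' [H ->]]]]]; first by exists x, c, y; split=> //; left.
  by exists x', c', y'; split=> //; right.
case=> x' [c' [y' [[[<- <- <-]|H] E]]]; first by rewrite E eqxx.
by apply/orP; right; apply/IH; exists x', c', y'.
Qed.

Definition reads w (c : config) : Prop :=
  brun (map (@nlet_of ka) (proj_alpha w)) (Some [::]) = Some c.2.1 /\
  brun (map (@nlet_of kb) (proj_beta w)) (Some [::]) = Some c.2.2.

Lemma search_sound v n c : c \in iter n (back_round plain_edges) [:: (v : nat, ([::], [::]))] ->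
  exists x w, [/\ c.1 = x, path_word x w v & reads w c].
Proof.
elim: n c => [|n IH] c /=.
  by rewrite inE => /eqP ->; exists v, [::]; split=> //; apply: path_nil.
case/back_roundP => [/IH //|[d /IH[y [w [Ed Hw [Ra Rb]]]] [e /plain_edgesP[x [a [y' [Ha ->]]]]]]].
rewrite /back_step /= /case_bool; case: eqP => // Ey.
have {}Ey : y' = y by apply: val_inj; rewrite /= -Ey -Ed.
subst y'; case: a Ha => a Ha /=.
  case Es: (bstep _ _) => [s|] //=; rewrite inE => /eqP ->.
  exists x, (inl a :: w); split=> //; first exact: path_cons Hw.
  by split=> //=; rewrite Ra.
case Es: (bstep _ _) => [s|] //=; rewrite inE => /eqP ->.
exists x, (inr a :: w); split=> //; first exact: path_cons Hw.
by split=> //=; rewrite Rb.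
Qed.

Lemma search_complete x w v n s t : path_word x w v -> size w <= n ->
  reads w (x : nat, (s, t)) ->
  (x : nat, (s, t)) \in iter n (back_round plain_edges) [:: (v : nat, ([::], [::]))].
Proof.
move=> Hw; elim: Hw n s t => {x w v} [u|u x a w v Ha _ IH] n s t Hn [Ra Rb].
  case: Ra Rb => <- [<-]; elim: n {Hn} => [|n IHn]; first by rewrite inE.
  by apply/back_roundP; left.
case: n Hn => // n; rewrite [size _]/= ltnS => Hn; apply/back_roundP; right.
case: a Ha Ra Rb => a Ha /= Ra Rb.
  case Es: (brun _ _) Ra => [s'|] /=; last by rewrite bstep_None.
  move=> Ra; exists (x : nat, (s', t)); first exact: IH.
  exists (u : nat, ((true, nlet_of a), x : nat)); last first.
    by rewrite /back_step /= /case_bool eqxx Ra /= inE.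
  by apply/plain_edgesP; exists u, (inl a), x.
case Es: (brun _ _) Rb => [t'|] /=; last by rewrite bstep_None.
move=> Rb; exists (x : nat, (s, t')); first exact: IH.
exists (u : nat, ((false, nlet_of a), x : nat)); last first.
  by rewrite /back_step /= /case_bool eqxx Rb /= inE.
by apply/plain_edgesP; exists u, (inr a), x.
Qed.

Lemma search_reachable u v n :
  (reachable u v -> exists w, [/\ path_word u w v, interleaved_dyck w & size w <= n]) ->
  search plain_edges n u v <-> reachable u v.
Proof.
move=> Hn; rewrite searchP; split.
  move/search_sound => [x [w [/= /val_inj <- Hw [Ra Rb]]]].
  by exists w; split=> //; split; apply/dyckP.
move/Hn => [w [Hw [/dyckP Da /dyckP Db] Hs]].
exact: search_complete Hw Hs _.
Qed.

End Search.

(** The expressions denote exactly the label words of paths, so a shorter word of the same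
    expression labels a path between the same nodes. *)
Lemma short_reachable (I : problem) : valid_problem I -> reachable (src I) (tgt I) ->
  exists w, [/\ path_word (src I) w (tgt I), interleaved_dyck w
    & size w <= path_bound (tree_size (code_exprs (exprs I))).+1].
Proof.
move=> [HP HW] [w [Hw Dw]]; have [r Hr Lr] := (HP w).2 Hw.
have [sigma Ew] := well_formed_word 0 (HW _ Hr) Lr; rewrite Ew in Dw.
have [sigma' D Hs] := short_interleaved_word Dw.
exists (words sigma' 0 (items r)); split=> //.
  by apply/HP; exists r => //; apply: words_lang; apply: HW.
apply: leq_trans Hs _; apply: path_bound_mono; rewrite ltnS.
exact: leq_trans (item_size_leq r) (tree_size_in Hr).
Qed.

Definition decode_edge (t : tree) : plain_edge :=
  (spine (hd t), (decode_label (hd (tl t)), spine (hd (tl (tl t))))).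

(** The expressions enter through the size of their code, which sets the number of rounds of the
    search in the graph. *)
Definition decide_tree (t : tree) : bool :=
  search (map decode_edge (elems (hd (tl (tl (tl t))))))
    (path_bound (tree_size (hd (tl (tl (tl (tl (tl (tl t)))))))).+1)
    (spine (hd (tl (tl (tl (tl t)))))) (spine (hd (tl (tl (tl (tl (tl t))))))).

Lemma computable_bstep X {cX : Code X} (a : X -> nlet) (s : X -> seq nat) :
  computable a -> computable s -> computable (fun x => bstep (a x) (Some (s x))).
Proof.
move=> Ha Hs; apply: (@computable_ext _ _ _ _ (fun x => case_bool (a x).1
  (case_seq (s x) None (fun j t => case_bool (j == (a x).2) (Some t) None))
  (Some ((a x).2 :: s x)))).
  by move=> x; rewrite /bstep; case: (a x) => [[] i] //=; case: (s x).
by computability.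
Qed.

Lemma computable_decide_tree : computable decide_tree.
Proof.
rewrite /decide_tree /search /back_round /back_step /accepting /decode_edge.
computability.
- by apply: computable_path_bound; computability; apply: computable_tree_size; computability.
all: by first [apply: computable_bstep | apply: computable_decode_label]; computability.
Qed.

Lemma decide_tree_correct (I : problem) : valid_problem I ->
  decide_tree (code_problem I) <-> reachable (src I) (tgt I).
Proof.
move=> V; rewrite -(search_reachable (short_reachable V)) /decide_tree /= !spine_nat.
suff -> : map decode_edge (elems (code_seq (@code_edge _ _ _) (edges (gr I)))) =
  plain_edges (gr I) by [].
rewrite /plain_edges; elim: (edges (gr I)) => //= -[[x c] y] es ->; congr cons.
by rewrite /decode_edge /= decode_label_code !spine_nat.
Qed.

Theorem theorem7 :
  (exists encode : cmd, forall I : problem, valid_problem I ->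
     exists es : seq (st_formula * st_formula),
       exec encode (code_exprs (exprs I)) (code_seq code_encoding es) /\
       List.Forall2 (fun r e => is_encoding r e) (exprs I) es) /\
  (exists decide : cmd, forall I : problem, valid_problem I ->
     exists b : bool,
       exec decide (code_problem I) (code_bool b) /\
       (b = true <-> reachable (src I) (tgt I))).
Proof.
split.
  have [c Hc] := encode_program; exists c => I [_ W]; exact: Hc.
have [c Hc] := computable_decide_tree; exists c => I V.
exists (decide_tree (code_problem I)); split; first exact: Hc.
exact: decide_tree_correct.
Qed.
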